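(* Let $\alpha = (\alpha_i)_{i\in\mathbb{N}}$ and $\beta = (\beta_i)_{i\in\mathbb{N}}$ be exponent sequences satisfying condition (N), and assume that $\alpha$ is stable. Let $X$ be a Hausdorff locally convex space. If $X \subseteq_c \Lambda_\infty(\alpha,\beta)$ and $\Lambda_\infty(\alpha,\beta) \subseteq_c X$, then $X \cong \Lambda_\infty(\alpha,\beta)$.
   Context: $\mathbb{N} = \{0,1,2,\ldots\}$. For Hausdorff locally convex spaces $X,Y$: $X\cong Y$ means that $X$ and $Y$ are topologically isomorphic, and $X \subseteq_c Y$ means that $X$ is topologically isomorphic to a complemented subspace of $Y$. An exponent sequence is a non-decreasing sequence $\alpha = (\alpha_i)_{i\in\mathbb{N}}$ of positive numbers with $\lim_{i\to\infty}\alpha_i = \infty$. It is stable if $\sup_{i} \alpha_{2i}/\alpha_i < \infty$. It satisfies condition (N) if $\sup_{i} \log(1+i)/\alpha_i < \infty$. For exponent sequences $\alpha,\beta$ and $n,N\in\mathbb{N}$ let $X_{n,N}$ be the Banach space of all $c = (c_{i,j})_{(i,j)\in\mathbb{N}^2}\in \mathbb{C}^{\mathbb{N}^2}$ with $\|c\|_{n,N} = \sup_{(i,j)\in\mathbb{N}^2} |c_{i,j}| e^{n\alpha_i - N\beta_j} < \infty$. Then $\Lambda_\infty(\alpha,\beta) = \varprojlim_{n\in\mathbb{N}} \varinjlim_{N\in\mathbb{N}} X_{n,N}$, i.e. the set of all $c$ such that for every $n$ there is $N$ with $\|c\|_{n,N}<\infty$, endowed with the projective limit topology of the locally convex inductive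 limits $\varinjlim_N X_{n,N}$. (If $\alpha,\beta$ satisfy (N), replacing the weighted sup-norms by the weighted $\ell^1$-norms gives the same space.) *)

(* Defs.v *)
From HB Require Import structures.
From mathcomp Require Import all_boot all_order all_algebra.
From mathcomp Require Import all_classical all_reals all_analysis.
From mathcomp Require Import interval_inference.
From mathcomp Require Import complex.

Set Implicit Arguments.
Unset Strict Implicit.
Unset Printing Implicit Defensive.

Import Order.TTheory GRing.Theory Num.Theory.
Import numFieldTopology.Exports numFieldNormedType.Exports.

Local Open Scope classical_set_scope.
Local Open Scope ring_scope.

Section AbsolutelyConvex.
Context {K : numFieldType} {E : lmodType K}.
Implicit Types (V : set E).

Definition balanced V := forall (a : K) x, `|a| <= 1 -> V x -> V (a *: x).

Definition absolutely_convex V := convex_set V /\ balanced V.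

Definition absorbing V := forall x : E,
  exists2 r : K, 0 < r & forall a, `|a| <= r -> V (a *: x).

Lemma min_gt0 (r s : K) : 0 < r -> 0 < s -> exists m, [/\ 0 < m, m <= r & m <= s].
Proof.
move=> r0 s0; have [rs|sr] := real_leP (gtr0_real r0) (gtr0_real s0).
  by exists r.
by exists s; rewrite (ltW sr).
Qed.

Lemma convex_setP V : convex_set V <->
  forall x y (t : K), 0 <= t -> t <= 1 -> V x -> V y -> V (t *: x + (1 - t) *: y).
Proof.
split=> [cV x y t t0 t1 Vx Vy|cV x y l].
  have t01 : Itv.spec (@Itv.num_sem K) (Itv.Real `[0%Z, 1%Z]) t.
    by rewrite /Itv.spec/= /Itv.num_sem/= in_itv/= t0 t1 ger0_real.
  have := cV x y (Itv.mk t01) (mem_set Vx) (mem_set Vy).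
  by rewrite inE.
rewrite !inE => Vx Vy.
by apply: cV.
Qed.

Lemma acx_half V x y : absolutely_convex V ->
  V (2 *: x) -> V (2 *: y) -> V (x + y).
Proof.
move=> [/convex_setP cV _] Vx Vy.
have h0 : (0 : K) <= 2^-1 by rewrite invr_ge0.
have h1 : (2^-1 : K) <= 1 by rewrite invf_le1// ler1n.
have := cV _ _ _ h0 h1 Vx Vy.
have -> : 1 - 2^-1 = 2^-1 :> K.
  by rewrite [X in X - _](splitr 1) mul1r addrK.
by rewrite !scalerA mulVf ?scale1r// pnatr_eq0.
Qed.

End AbsolutelyConvex.

(* A locally convex topology from its filter of neighbourhoods of 0. *)
HB.factory Record Lmodule_isTvs (K : numFieldType) E & GRing.Lmodule K E := {
  nbhs_zero : set_system E ;
  nbhs_zero_filter : Filter nbhs_zero ;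
  nbhs_zero_acx : forall U, nbhs_zero U ->
    exists V, [/\ nbhs_zero V, absolutely_convex V & V `<=` U] ;
  nbhs_zero_absorbing : forall U, nbhs_zero U -> absorbing U ;
  nbhs_zero_scale : forall (a : K) U, a != 0 -> nbhs_zero U ->
    nbhs_zero [set x | U (a *: x)]
}.

HB.builders Context K E & Lmodule_isTvs K E.

HB.instance Definition _ :=
  hasNbhs.Build E (fun x => [set U | nbhs_zero [set y | U (x + y)]]).

Let nbhsxE (x : E) U : nbhs x U = nbhs_zero [set y | U (x + y)].
Proof. by []. Qed.

Let nz_filter : Filter nbhs_zero. Proof. exact: nbhs_zero_filter. Qed.
#[local] Existing Instance nz_filter.

Let nz0 U : nbhs_zero U -> U 0.
Proof.
move=> /nbhs_zero_absorbing /(_ 0)[r r0 /(_ 0)].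
by rewrite normr0 scaler0; apply; exact: ltW.
Qed.

Let nz_half U : nbhs_zero U -> exists2 W, nbhs_zero W &
  forall x y, W x -> W y -> U (x + y).
Proof.
move=> /nbhs_zero_acx[V [NV aV VU]]; exists [set x | V (2 *: x)].
  by apply: nbhs_zero_scale => //; rewrite pnatr_eq0.
move=> x y Vx Vy; apply: VU; exact: (acx_half aV).
Qed.

Let nbhs_filterE (x : E) : ProperFilter (nbhs x).
Proof.
split.
  by rewrite nbhsxE => /nz0; case.
split; rewrite /nbhs/=.
- exact: filterT.
- by move=> P Q /= NP NQ; exact: filterI.
- by move=> P Q PQ; apply: filterS => y; exact: PQ.
Qed.

Let nbhs_singletonE (x : E) (A : set E) : nbhs x A -> A x.
Proof. by rewrite nbhsxE => /nz0/=; rewrite addr0. Qed.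

Let nbhs_nbhsE (x : E) (A : set E) : nbhs x A -> nbhs x (nbhs^~ A).
Proof.
rewrite nbhsxE => /nz_half[W NW WA]; rewrite nbhsxE.
apply: filterS (NW) => y Wy /=.
by apply: filterS NW => z Wz /=; rewrite -addrA; exact: WA.
Qed.

HB.instance Definition _ := Nbhs_isNbhsTopological.Build E
  nbhs_filterE nbhs_singletonE nbhs_nbhsE.

Let nbhs_translate (x : E) U : nbhs_zero U -> nbhs x [set y | U (y - x)].
Proof.
move=> NU; rewrite nbhsxE; apply: filterS NU => y Uy /=.
by rewrite addrC addKr.
Qed.

Let add_cont : continuous (fun x : E * E => x.1 + x.2).
Proof.
move=> [x y] U; rewrite /= => NU.
have {NU} : nbhs_zero [set z | U (x + y + z)] by [].
move=> /nz_half[W NW WU].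
exists ([set z | W (z - x)], [set z | W (z - y)]) => /=.
  by split; exact: nbhs_translate.
move=> [a b] /= [Wa Wb]; have := WU _ _ Wa Wb.
by rewrite /= [a - x + _]addrACA -opprD [x + y + _]addrC subrK.
Qed.

Let scale_cont : continuous (fun z : K^o * E => z.1 *: z.2).
Proof.
move=> [k x] U; rewrite /= => NU.
have {NU} : nbhs_zero [set z | U (k *: x + z)] by [].
move=> /nz_half[W /nbhs_zero_acx[V [NV [_ bV] VW]] WU].
have [r r0 rV] := nbhs_zero_absorbing NV x.
pose M := `|k| + r; have M0 : 0 < M by rewrite ltr_wpDl.
have Mneq0 : M != 0 by rewrite gt_eqF.
exists ([set l | `|k - l| < r], [set z | V (M *: (z - x))]) => /=.
  split; first by exists r.
  apply: (@nbhs_translate x [set z | V (M *: z)]).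
  exact: nbhs_zero_scale.
move=> [l z] /= [kl Vz].
have lM : `|l| <= M.
  rewrite -[l](subrK k) addrC (le_trans (ler_normD _ _))// lerD2l.
  by rewrite distrC ltW.
have -> : l *: z = k *: x + ((l - k) *: x + l *: (z - x)).
  by rewrite scalerBl scalerBr addrA [k *: x + _]addrC subrK addrC subrK.
apply: WU; apply: VW; first by apply: rV; rewrite distrC ltW.
have -> : l *: (z - x) = (l / M) *: (M *: (z - x)).
  by rewrite scalerA divfK.
by apply: bV => //; rewrite normf_div (gtr0_norm M0) ler_pdivrMr ?mul1r.
Qed.

Let locally_cvx : exists2 B : set_system E,
  (forall b, b \in B -> convex_set b) & basis B.
Proof.
exists [set b | open b /\ convex_set b]; first by move=> b /set_mem[].
split=> [b []//|x U].
rewrite [nbhs x U]nbhsxE => /nbhs_zero_acx[V [NV [/convex_setP cV bV] VU]].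
pose b : set E := (fun y => x + y) @` V.
have cb : convex_set b.
  apply/convex_setP => _ _ t t0 t1 [y Vy <-] [z Vz <-].
  exists (t *: y + (1 - t) *: z); first exact: cV.
  by rewrite !scalerDr addrACA -scalerDl [t + _]addrC subrK scale1r.
exists b°; last first.
  by apply: (subset_trans (@interior_subset _ _)) => _ [y Vy <-]; exact: VU.
split; last first.
  by rewrite /interior nbhsxE; apply: filterS NV => y Vy /=; exists y.
split; first exact: open_interior.
apply/convex_setP => y z t t0 t1; rewrite /interior !nbhsxE => Ny Nz.
apply: filterS (filterI Ny Nz) => w /= [yw zw].
have := (convex_setP b).1 cb _ _ _ t0 t1 yw zw.
by rewrite !scalerDr addrACA -[_ *: w + _]scalerDl [t + _]addrC subrK scale1r.
Qed.

HB.instance Definition _ := PreTopologicalLmod_isTvs.Build K E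
  add_cont scale_cont locally_cvx.
HB.instance Definition _ :=
  PreTopologicalNmodule_isTopologicalNmodule.Build E add_cont.
HB.instance Definition _ :=
  TopologicalNmodule_isTopologicalLmodule.Build K E scale_cont.
HB.instance Definition _ := Uniform_isTvs.Build K E locally_cvx.

HB.end.

Section TvsNeighbourhoods.
Context {K : numFieldType} (E : tvsType K).
Implicit Types U : set E.

Lemma nbhs0_absorbing U : nbhs 0 U -> absorbing U.
Proof.
move=> NU x; have := @scale_continuous K E (0, x) U; rewrite /= scale0r.
move=> /(_ NU)[[A B] /= [[r /= r0 rA] NB]] AB; exists (r / 2).
  by rewrite divr_gt0.
move=> a ar; apply: (AB (a, x)); split => /=; last exact: nbhs_singleton.
apply: rA; rewrite /= sub0r normrN (le_lt_trans ar)//.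
by rewrite ltr_pdivrMr// ltr_pMr// ltr1n.
Qed.

Lemma nbhs0_scale (a : K) U : a != 0 -> nbhs 0 U -> nbhs 0 [set x | U (a *: x)].
Proof.
move=> a0 NU; have := @nbhs0Z K E U a^-1; rewrite invr_eq0 => /(_ a0 NU).
by apply: filterS => _ [y Uy <-] /=; rewrite scalerA divff// scale1r.
Qed.

Lemma nbhs0_acx U : nbhs 0 U ->
  exists V, [/\ nbhs 0 V, absolutely_convex V & V `<=` U].
Proof.
move=> NU; have [B Bcvx [Bop /(_ 0 U NU)[C [/mem_set BC C0] CU]]] :=
  @locally_convex K E.
have /convex_setP cC := Bcvx _ BC.
have NC : nbhs 0 C by apply: open_nbhs_nbhs; split=> //; exact: Bop (set_mem BC).
exists [set x | forall a : K, `|a| <= 1 -> C (a *: x)]; split.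
- have := @scale_continuous K E (0, 0) C; rewrite /= scale0r.
  move=> /(_ NC)[[A A'] /= [[r /= r0 rA] NA']] AA'.
  have r20 : r / 2 != 0 by rewrite gt_eqF// divr_gt0.
  apply: filterS (nbhs0Z r20 NA') => _ [y A'y <-] a a1 /=.
  rewrite scalerA; apply: (AA' (a * (r / 2), y)); split => //=.
  apply: rA; rewrite /= sub0r normrN normrM (gtr0_norm (divr_gt0 r0 _))//.
  rewrite (@le_lt_trans _ _ (r / 2))// ?ler_piMl// ?ltW// ?divr_gt0//.
  by rewrite ltr_pdivrMr// ltr_pMr// ltr1n.
- split.
    apply/convex_setP => x y t t0 t1 Cx Cy a a1.
    rewrite scalerDr !scalerA ![a * _]mulrC -!scalerA.
    by apply: cC => //; [exact: Cx|exact: Cy].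
  move=> a x a1 Cx b b1; rewrite scalerA; apply: Cx.
  by rewrite normrM mulr_ile1.
- by move=> x /(_ 1); rewrite normr1 scale1r => /(_ (lexx _)) /CU.
Qed.

End TvsNeighbourhoods.

Section FinalTopology.
Context {K : numFieldType} {I : Type} {F : I -> tvsType K} {E : lmodType K}.
Variable f : forall i, {linear F i -> E}.

(* E with the finest locally convex topology making all the f i continuous;
   this is the locally convex inductive limit topology when E is the union of
   the images of the f i. *)
Definition lc_final of (forall i, {linear F i -> E}) : Type := E.

Definition lc_final_nbhs0 : set_system E := [set U | exists V,
  [/\ absolutely_convex V, absorbing V,
      (forall i, nbhs 0 (f i @^-1` V)) & V `<=` U]].

HB.instance Definition _ := GRing.Lmodule.on (lc_final f).

Lemma lc_final_filter : Filter lc_final_nbhs0.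
Proof.
split.
- exists setT; split=> //.
  + by split=> [x y l _ _|a x _ _] //; apply/mem_set.
  + by move=> x; exists 1.
  + by move=> i; exact: filterT.
- move=> P Q [V [[cV bV] aV fV VP]] [W [[cW bW] aW fW WQ]].
  exists (V `&` W); split.
  + split; last by move=> a x a1 [Vx Wx]; split; [exact: bV|exact: bW].
    move/convex_setP: cV; move/convex_setP: cW => cW cV; apply/convex_setP.
    by move=> x y t t0 t1 [? ?] [? ?]; split; [exact: cV|exact: cW].
  + move=> x; have [r r0 rV] := aV x; have [s s0 sW] := aW x.
    have [m [m0 mr ms]] := min_gt0 r0 s0; exists m => // a am.
    by split; [apply: rV|apply: sW]; exact: le_trans am _.
  + by move=> i; rewrite preimage_setI; exact: filterI.
  + exact: setISS.
- by move=> P Q PQ [V [? ? ? VP]]; exists V; split=> //; exact: (subset_trans VP PQ).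
Qed.

Lemma lc_final_acx U : lc_final_nbhs0 U ->
  exists V, [/\ lc_final_nbhs0 V, absolutely_convex V & V `<=` U].
Proof. by case=> V [cV aV fV VU]; exists V; split=> //; exists V; split. Qed.

Lemma lc_final_absorbing U : lc_final_nbhs0 U -> absorbing U.
Proof.
case=> V [_ aV _ VU] x; have [r r0 rV] := aV x.
by exists r => // a /rV /VU.
Qed.

Lemma lc_final_scale (a : K) U : a != 0 -> lc_final_nbhs0 U ->
  lc_final_nbhs0 [set x | U (a *: x)].
Proof.
move=> a0 [V [[/convex_setP cV bV] aV fV VU]].
exists [set x | V (a *: x)]; split.
- split.
    apply/convex_setP => x y t t0 t1 Vx Vy /=.
    rewrite scalerDr !scalerA ![a * _]mulrC -!scalerA.
    exact: cV.
  by move=> b x b1 Vx /=; rewrite scalerA mulrC -scalerA; exact: bV.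
- by move=> x; have [r r0 rV] := aV (a *: x); exists r => // b /rV;
    rewrite scalerA mulrC -scalerA.
- move=> i; apply: filterS (nbhs0_scale a0 (fV i)) => x /=.
  by rewrite linearZ.
- by move=> x /VU.
Qed.

HB.instance Definition _ := Lmodule_isTvs.Build K (lc_final f)
  lc_final_filter lc_final_acx lc_final_absorbing lc_final_scale.

End FinalTopology.

Section InitialTopology.
Context {K : numFieldType} {I : eqType} {G : I -> tvsType K} {E : lmodType K}.
Variable g : forall i, {linear E -> G i}.

(* E with the coarsest topology making all the g i continuous; this is the
   projective limit topology when the g i identify E with the set of threads. *)
Definition lc_initial of (forall i, {linear E -> G i}) : Type := E.

Definition lc_initial_nbhs0 : set_system E := [set U |
  exists (s : seq I) (W : forall i, set (G i)),
    (forall i, nbhs 0 (W i)) /\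
    [set x | forall i, i \in s -> W i (g i x)] `<=` U].

HB.instance Definition _ := GRing.Lmodule.on (lc_initial g).

Lemma lc_initial_filter : Filter lc_initial_nbhs0.
Proof.
split.
- by exists [::], (fun=> setT); split=> // i; exact: filterT.
- move=> P Q [s [V [NV VP]]] [t [W [NW WQ]]].
  exists (s ++ t), (fun i => V i `&` W i); split; first by move=> i; exact: filterI.
  move=> x stx; split; [apply: VP => i si|apply: WQ => i ti].
    by have [] := stx i; first by rewrite mem_cat si.
  by have [] := stx i; first by rewrite mem_cat ti orbT.
- by move=> P Q PQ [s [V [NV VP]]]; exists s, V; split=> //; exact: (subset_trans VP PQ).
Qed.

Lemma lc_initial_acx U : lc_initial_nbhs0 U ->
  exists V, [/\ lc_initial_nbhs0 V, absolutely_convex V & V `<=` U].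
Proof.
case=> s [W [NW WU]].
pose V i := sval (cid (nbhs0_acx (NW i))).
have VP i : [/\ nbhs 0 (V i), absolutely_convex (V i) & V i `<=` W i].
  exact: svalP (cid (nbhs0_acx (NW i))).
exists [set x | forall i, i \in s -> V i (g i x)]; split.
- by exists s, V; split=> // i; case: (VP i).
- split.
    apply/convex_setP => x y t t0 t1 Vx Vy i si.
    rewrite linearD !linearZ; have [_ [/convex_setP cV _] _] := VP i.
    by apply: cV => //; [exact: Vx|exact: Vy].
  move=> a x a1 Vx i si; rewrite linearZ; have [_ [_ bV] _] := VP i.
  by apply: bV => //; exact: Vx.
- by move=> x Vx; apply: WU => i si; have [_ _] := VP i; apply; exact: Vx.
Qed.

Lemma lc_initial_absorbing U : lc_initial_nbhs0 U -> absorbing U.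
Proof.
case=> s [W [NW WU]] x.
suff [r r0 rW] : exists2 r : K, 0 < r &
    forall a, `|a| <= r -> forall i, i \in s -> W i (g i (a *: x)).
  by exists r => // a /rW aW; exact: WU.
elim: s {WU} => [|i s [r r0 rW]]; first by exists 1.
have [q q0 qW] := nbhs0_absorbing (NW i) (g i x).
have [m [m0 mr mq]] := min_gt0 r0 q0.
exists m => // a am j; rewrite in_cons => /predU1P[->|sj].
  by rewrite linearZ; apply: qW; exact: le_trans am _.
by apply: rW => //; exact: le_trans am _.
Qed.

Lemma lc_initial_scale (a : K) U : a != 0 -> lc_initial_nbhs0 U ->
  lc_initial_nbhs0 [set x | U (a *: x)].
Proof.
move=> a0 [s [W [NW WU]]].
exists s, (fun i => [set x | W i (a *: x)]); split.
  by move=> i; exact: nbhs0_scale.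
by move=> x Wx; apply: WU => i si; rewrite linearZ; exact: Wx.
Qed.

HB.instance Definition _ := Lmodule_isTvs.Build K (lc_initial g)
  lc_initial_filter lc_initial_acx lc_initial_absorbing lc_initial_scale.

End InitialTopology.

Section UniversalProperties.
Context {K : numFieldType}.

Lemma linear_continuous0 (E G : tvsType K) (h : {linear E -> G}) :
  (forall U, nbhs 0 U -> nbhs 0 (h @^-1` U)) -> continuous h.
Proof.
move=> h0 x U NU.
have : nbhs 0 (h @^-1` [set y | U (h x + y)]).
  apply: h0; have := nbhsB (- h x) NU; rewrite addNr.
  by apply: filterS => _ [y Uy <-]; rewrite /= addNKr.
move=> /(nbhsT x); apply: filterS => _ [y Uy <-].
by rewrite /= linearD.
Qed.

Lemma lc_final_nbhs0E (I : Type) (F : I -> tvsType K) (E : lmodType K)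
    (f : forall i, {linear F i -> E}) (U : set (lc_final f)) :
  nbhs 0 U = lc_final_nbhs0 f U.
Proof.
rewrite [LHS](_ : _ = lc_final_nbhs0 f [set y | U (0 + y)])//.
by congr lc_final_nbhs0; apply/funext => y /=; rewrite add0r.
Qed.

Lemma lc_initial_nbhs0E (I : eqType) (G : I -> tvsType K) (E : lmodType K)
    (g : forall i, {linear E -> G i}) (U : set (lc_initial g)) :
  nbhs 0 U = lc_initial_nbhs0 g U.
Proof.
rewrite [LHS](_ : _ = lc_initial_nbhs0 g [set y | U (0 + y)])//.
by congr lc_initial_nbhs0; apply/funext => y /=; rewrite add0r.
Qed.

Lemma lc_final_continuousP (I : Type) (F : I -> tvsType K) (E : lmodType K)
    (f : forall i, {linear F i -> E}) (G : tvsType K)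
    (h : {linear lc_final f -> G}) :
  continuous h <-> forall i, continuous (fun x : F i => h (f i x)).
Proof.
split=> [ch i|hf].
  pose fi : {linear F i -> lc_final f} := f i.
  suff cf : continuous fi.
    by move=> x; apply: (@continuous_comp _ _ _ fi h); [exact: cf|exact: ch].
  apply: (@linear_continuous0 (F i) (lc_final f) fi) => U.
  rewrite lc_final_nbhs0E => -[V [_ _ /(_ i) fV VU]].
  by apply: filterS fV => x; exact: VU.
apply: linear_continuous0 => U /nbhs0_acx[V [NV [/convex_setP cV bV] VU]].
rewrite lc_final_nbhs0E; exists (h @^-1` V); split.
- split.
    apply/convex_setP => x y t t0 t1 Vx Vy.
    by rewrite /preimage/= linearD !linearZ; exact: cV.
  by move=> a x a1 Vx; rewrite /preimage/= linearZ; exact: bV.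
- move=> x; have [r r0 rV] := nbhs0_absorbing NV (h x).
  by exists r => // a ar; rewrite /preimage/= linearZ; exact: rV.
- move=> i; have := hf i 0 V; rewrite /= !linear0; exact.
- by move=> x; exact: VU.
Qed.

Lemma lc_initial_continuousP (I : eqType) (G : I -> tvsType K) (E : lmodType K)
    (g : forall i, {linear E -> G i}) (F : tvsType K)
    (h : {linear F -> lc_initial g}) :
  continuous h <-> forall i, continuous (fun x : F => g i (h x)).
Proof.
split=> [ch i|hg].
  pose gi : {linear lc_initial g -> G i} := g i.
  suff cg : continuous gi.
    by move=> x; apply: (@continuous_comp _ _ _ h gi); [exact: ch|exact: cg].
  apply: (@linear_continuous0 (lc_initial g) (G i) gi) => U NU.
  rewrite lc_initial_nbhs0E; exists [:: i].
  exists (fun j => [set y | forall e : j = i, U (ecast k (G k) e y)]); split.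
    move=> j; have [ji|nji] := pselect (j = i); last by apply: filterE => y e.
    by subst j; apply: filterS NU => y Uy e; rewrite eq_axiomK.
  by move=> x /(_ i); rewrite mem_head => /(_ erefl erefl).
apply: linear_continuous0 => U; rewrite lc_initial_nbhs0E.
move=> [s [W [NW WU]]].
suff : nbhs 0 [set x | forall i, i \in s -> W i (g i (h x))].
  by apply: filterS => x Wx; exact: WU.
elim: s {WU} => [|i s IHs]; first by apply: filterE => x i; rewrite in_nil.
have := hg i 0 (W i); rewrite /= !linear0 => /(_ (NW i)).
move: IHs; apply: filterS2 => x Ws Wi j.
rewrite in_cons => /predU1P[->|sj]; first exact: Wi.
exact: Ws.
Qed.

End UniversalProperties.

Section Isomorphism.
Context {K : numFieldType}.

Definition tvs_iso (X Y : tvsType K) := exists f : {linear X -> Y},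
  exists g : {linear Y -> X},
    [/\ continuous f, continuous g, cancel f g & cancel g f].

Definition complemented (Y : tvsType K) (F : set Y) :=
  exists P : {linear Y -> Y},
    [/\ continuous P, forall y, P (P y) = P y & range P = F].

(* X is topologically isomorphic to the subspace F of Y *)
Definition tvs_iso_subspace (X Y : tvsType K) (F : set Y) :=
  exists f : {linear X -> Y}, exists g : Y -> X,
    [/\ continuous f, range f = F, cancel f g & {within F, continuous g}].

Definition complemented_in (X Y : tvsType K) :=
  exists2 F : set Y, complemented F & tvs_iso_subspace X F.

End Isomorphism.

Section Submodule.
Context {K : numFieldType} {V : lmodType K}.

Record submod (S : submodClosed V) :=
  Submod { submod_val :> V ; submod_valP : submod_val \in S }.

HB.instance Definition _ (S : submodClosed V) := [isSub for @submod_val S].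
HB.instance Definition _ (S : submodClosed V) := [Choice of submod S by <:].
HB.instance Definition _ (S : submodClosed V) :=
  [SubChoice_isSubLmodule of submod S by <:].

Variables S T : submodClosed V.
Hypothesis ST : {subset S <= T}.

Definition submod_incl (x : submod S) : submod T := Submod (ST (submod_valP x)).

Lemma submod_incl_linear : linear submod_incl.
Proof. by move=> a x y; apply/val_inj. Qed.

HB.instance Definition _ :=
  GRing.isLinear.Build K (submod S) (submod T) _ submod_incl submod_incl_linear.

End Submodule.

Section KoetheSpace.
Context {R : realType}.

Record exponent_sequence := ExponentSequence {
  expseq :> nat -> R ;
  expseq_gt0 : forall i, 0 < expseq i ;
  expseq_nd : nondecreasing_seq expseq ;
  expseq_pinfty : expseq @ \oo --> +oo }.

Definition stable (a : exponent_sequence) :=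
  (ereal_sup (range (fun i => (a (2 * i)%N / a i)%:E)) < +oo)%E.

Definition condition_N (a : exponent_sequence) :=
  (ereal_sup (range (fun i => (ln (1 + i%:R) / a i)%:E)) < +oo)%E.

Variables alpha beta : exponent_sequence.
Implicit Types (c : nat * nat -> R[i]) (n N : nat).

Definition weight n N (ij : nat * nat) : R :=
  expR (n%:R * alpha ij.1 - N%:R * beta ij.2).

Definition wnorm n N c : \bar R :=
  ereal_sup (range (fun ij => (Normc.normc (c ij) * weight n N ij)%:E)).

Lemma normc_ge0 (z : R[i]) : 0 <= Normc.normc z.
Proof. by case: z => a b; exact: sqrtr_ge0. Qed.

Lemma wnorm_ub n N c ij : ((Normc.normc (c ij) * weight n N ij)%:E <= wnorm n N c)%E.
Proof. by apply: ereal_sup_ubound; exists ij. Qed.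

Lemma wnorm_ge0 n N c : (0 <= wnorm n N c)%E.
Proof.
apply: (le_trans _ (wnorm_ub n N c (0, 0)%N)).
by rewrite lee_fin mulr_ge0 ?normc_ge0 ?expR_ge0.
Qed.

Lemma wnormD n N c d : (wnorm n N (c + d)%R <= wnorm n N c + wnorm n N d)%E.
Proof.
apply: ge_ereal_sup => _ [ij _ <-].
apply: (le_trans _ (leeD (wnorm_ub n N c ij) (wnorm_ub n N d ij))).
by rewrite -EFinD lee_fin -mulrDl ler_wpM2r ?expR_ge0//; exact: le_normcD.
Qed.

Lemma wnormZ_le n N (a : R[i]) c :
  (wnorm n N (a *: c)%R <= (Normc.normc a)%:E * wnorm n N c)%E.
Proof.
apply: ge_ereal_sup => _ [ij _ <-].
rewrite (_ : Normc.normc _ = Normc.normc a * Normc.normc (c ij)); last first.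
  exact: Normc.normcM.
rewrite -mulrA EFinM; apply: lee_wpmul2l; first by rewrite lee_fin normc_ge0.
exact: wnorm_ub.
Qed.

Lemma wnormZ n N (a : R[i]) c :
  (wnorm n N (a *: c)%R = (Normc.normc a)%:E * wnorm n N c)%E.
Proof.
apply/eqP; rewrite eq_le wnormZ_le/=.
have [->|a0] := eqVneq a 0.
  by rewrite Normc.normc0 mul0e wnorm_ge0.
have na0 : 0 < Normc.normc a.
  rewrite lt_neqAle normc_ge0 andbT eq_sym.
  by apply: contra a0 => /eqP/Normc.eq0_normc ->.
rewrite -lee_pdivlMl//; have := wnormZ_le n N a^-1 (a *: c).
by rewrite scalerA mulVf// scale1r Normc.normcV.
Qed.

Lemma wnorm0 n N : wnorm n N 0 = 0%E.
Proof. by rewrite -(scale0r 0) wnormZ Normc.normc0 mul0e. Qed.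

Lemma wnorm_le n N M c : (N <= M)%N -> (wnorm n M c <= wnorm n N c)%E.
Proof.
move=> NM; apply: ge_ereal_sup => _ [ij _ <-].
apply: (le_trans _ (wnorm_ub n N c ij)).
rewrite lee_fin ler_wpM2l ?normc_ge0// ler_expR lerD2l lerN2.
by rewrite ler_wpM2r ?ler_nat// ltW// expseq_gt0.
Qed.

Definition wsup_pred n N : {pred nat * nat -> R[i]} :=
  fun c => `[< (wnorm n N c < +oo)%E >].

Definition union_pred n : {pred nat * nat -> R[i]} :=
  fun c => `[< exists N, (wnorm n N c < +oo)%E >].

Definition lambda_pred : {pred nat * nat -> R[i]} :=
  fun c => `[< forall n, exists N, (wnorm n N c < +oo)%E >].

Lemma wnorm_comb n N (a : R[i]) c d : (wnorm n N c < +oo)%E ->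
  (wnorm n N d < +oo)%E -> (wnorm n N (a *: c + d)%R < +oo)%E.
Proof.
move=> cy dy; apply: (le_lt_trans (wnormD _ _ _ _)).
rewrite lte_add_pinfty// wnormZ lte_mul_pinfty ?lee_fin ?normc_ge0//.
Qed.

Lemma union_comb n (a : R[i]) c d : (exists N, (wnorm n N c < +oo)%E) ->
  (exists N, (wnorm n N d < +oo)%E) ->
  exists N, (wnorm n N (a *: c + d)%R < +oo)%E.
Proof.
move=> [N cy] [M dy]; exists (maxn N M); apply: wnorm_comb.
  by apply: le_lt_trans cy; apply: wnorm_le; exact: leq_maxl.
by apply: le_lt_trans dy; apply: wnorm_le; exact: leq_maxr.
Qed.

Lemma wsup_closed n N : submod_closed (wsup_pred n N).
Proof.
split; first by apply/asboolP; rewrite wnorm0.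
by move=> a c d /asboolP cy /asboolP dy; apply/asboolP; exact: wnorm_comb.
Qed.

Lemma union_closed n : submod_closed (union_pred n).
Proof.
split; first by apply/asboolP; exists 0%N; rewrite wnorm0.
by move=> a c d /asboolP cy /asboolP dy; apply/asboolP; exact: union_comb.
Qed.

Lemma lambda_closed : submod_closed lambda_pred.
Proof.
split; first by apply/asboolP => n; exists 0%N; rewrite wnorm0.
move=> a c d /asboolP cy /asboolP dy; apply/asboolP => n.
exact: union_comb.
Qed.

HB.instance Definition _ n N :=
  GRing.isSubmodClosed.Build _ _ (wsup_pred n N) (wsup_closed n N).
HB.instance Definition _ n :=
  GRing.isSubmodClosed.Build _ _ (union_pred n) (union_closed n).
HB.instance Definition _ :=
  GRing.isSubmodClosed.Build _ _ lambda_pred lambda_closed.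

Definition wsup_space n N : Type := submod (wsup_pred n N).

HB.instance Definition _ n N := GRing.Lmodule.on (wsup_space n N).

Section WsupNorm.
Variables n N : nat.
Implicit Types u v : wsup_space n N.

Definition wsup_norm u : R[i] := (fine (wnorm n N (submod_val u)))%:C%C.

Lemma wsup_fin u : wnorm n N (submod_val u) \is a fin_num.
Proof.
by rewrite ge0_fin_numE ?wnorm_ge0//; exact/asboolP/(submod_valP u).
Qed.

Lemma wsup_normD u v : wsup_norm (u + v) <= wsup_norm u + wsup_norm v.
Proof.
rewrite -rmorphD lecR -fineD ?wsup_fin// fine_le ?fin_numD ?wsup_fin//.
exact: wnormD.
Qed.

Lemma wsup_normZ (a : R[i]) u : wsup_norm (a *: u) = `|a| * wsup_norm u.
Proof.
have vZ : submod_val (a *: u) = a *: submod_val u by [].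
rewrite /wsup_norm vZ wnormZ fineM ?wsup_fin// rmorphM.
by congr (_ * _); case: (a).
Qed.

Lemma wsup_norm0_eq0 u : wsup_norm u = 0 -> u = 0.
Proof.
move=> [] c0; apply/val_inj/funext => ij; apply: Normc.eq0_normc.
have := wnorm_ub n N (submod_val u) ij.
rewrite -(fineK (wsup_fin u)) c0 lee_fin => h.
apply/eqP; rewrite eq_le normc_ge0 andbT.
by move: h; rewrite pmulr_lle0 ?expR_gt0.
Qed.

HB.instance Definition _ := Lmodule_isNormed.Build R[i] (wsup_space n N)
  wsup_normD wsup_normZ wsup_norm0_eq0.

End WsupNorm.

Lemma sub_wsup_union n N : {subset wsup_pred n N <= union_pred n}.
Proof. by move=> c /asboolP cy; apply/asboolP; exists N. Qed.

Lemma sub_lambda_union n : {subset lambda_pred <= union_pred n}.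
Proof. by move=> c /asboolP cy; apply/asboolP. Qed.

Definition wsup_incl n N : {linear wsup_space n N -> submod (union_pred n)} :=
  submod_incl (@sub_wsup_union n N).

(* LB_space n is the locally convex inductive limit over N of the Banach spaces
   wsup_space n N; its carrier is their union, so lc_final applies. *)
Definition LB_space n : tvsType R[i] := lc_final (wsup_incl n).

Definition lambda_incl n : {linear submod lambda_pred -> LB_space n} :=
  submod_incl (@sub_lambda_union n).

(* The threads of the projective spectrum of the LB_space n, with inclusions as
   linking maps, are the elements of the intersection of these spaces. *)
Definition Lambda_infty : tvsType R[i] := lc_initial lambda_incl.

End KoetheSpace.

Arguments exponent_sequence : clear implicits.

(* Main.v *)
Require Import Defs.
From HB Require Import structures.
From mathcomp Require Import all_boot all_order all_algebra.
From mathcomp Require Import all_classical all_reals all_analysis.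
From mathcomp Require Import complex.
From mathcomp Require Import ring lra zify.

(**
  Write L for Lambda_infty(alpha, beta). If L is complemented in X and L = L + L
  (even and odd rows, by stability), then X = X + L; so it is enough to show
  X + L = L for every complemented subspace X of L. Weighted infinite sums of
  copies of L are in general too large to be L again, so Pelczynski's swindle
  does not apply directly. But there is an exact sequence

    0 --> L --S--> L --q--> L^N --> 0

  through which every continuous T : L -> L^N lifts. On the product L^N the
  swindle L^N = X + L^N is harmless, and Schanuel's argument carries it back
  to L: it gives L + L = L + X + L.

  For the sequence, split the rows by a bijection (k, p, i) |-> idx k p i of
  N^3 onto N with alpha (idx k (p + 1) i) <= const * alpha (idx k p i)
  uniformly in k, put om k p i = alpha (idx k p i), and let q_k x be
  sum_p exp(k om k p i) x_(idx k p i). A vector of row weight om and size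
  exp(-k om) costs nothing at the levels n < k; this makes room for the lift.
*)

Set Implicit Arguments.
Unset Strict Implicit.
Unset Printing Implicit Defensive.

Import Order.TTheory GRing.Theory Num.Theory.
Import numFieldTopology.Exports numFieldNormedType.Exports.

Local Open Scope classical_set_scope.
Local Open Scope ring_scope.

(** * Continuous linear maps and retracts *)

Section ContinuousLinear.
Context {K : numFieldType}.

(** Unbundled, so that lambda terms and maps obtained by choice compose without structure
    declarations; [clin_linear_fun] bundles them again. *)
Definition clin (E F : tvsType K) (f : E -> F) := linear f /\ continuous f.

Section Algebra.
Variables (E F : tvsType K) (f : E -> F).
Hypothesis fl : clin f.

Lemma clinD x y : f (x + y) = f x + f y.
Proof. by have := fl.1 1 x y; rewrite !scale1r. Qed.

Lemma clin0 : f 0 = 0.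
Proof. by apply: (addrI (f 0)); rewrite -clinD !addr0. Qed.

Lemma clinZ a x : f (a *: x) = a *: f x.
Proof. by have := fl.1 a x 0; rewrite clin0 !addr0. Qed.

Lemma clinB x y : f (x - y) = f x - f y.
Proof. by rewrite clinD -scaleN1r clinZ scaleN1r. Qed.

Lemma clin_linear_fun : exists g : {linear E -> F}, g =1 f.
Proof.
have lf : linear_for *:%R f by exact: fl.1.
pose lin := GRing.isLinear.Build K E F *:%R f lf.
pose g : {linear E -> F} := HB.pack f lin.
by exists g.
Qed.

End Algebra.

Lemma linear_clin (E F : tvsType K) (f : {linear E -> F}) :
  continuous f -> clin f.
Proof. by move=> cf; split=> // a x y; exact: linearP. Qed.

Lemma clin_id (E : tvsType K) : clin (fun x : E => x).
Proof. by split=> // x; exact: cvg_id. Qed.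

Lemma clin_cst0 (E F : tvsType K) : clin (fun _ : E => 0 : F).
Proof. by split=> [a x y|x]; [rewrite scaler0 addr0|exact: cvg_cst]. Qed.

Lemma clin_comp (E F G : tvsType K) (g : F -> G) (f : E -> F) :
  clin g -> clin f -> clin (fun x => g (f x)).
Proof.
move=> [lg cg] [lf cf]; split=> [a x y|x]; first by rewrite lf lg.
by apply: (@continuous_comp _ _ _ f g); [exact: cf|exact: cg].
Qed.

Lemma clin_add (E F : tvsType K) (f g : E -> F) :
  clin f -> clin g -> clin (fun x => f x + g x).
Proof.
move=> [lf cf] [lg cg]; split=> [a x y|x].
  by rewrite lf lg scalerDr addrACA.
apply: (@continuous_comp _ _ _ (fun x => (f x, g x)) (fun z => z.1 + z.2)).
  by apply: cvg_pair; [exact: cf|exact: cg].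
exact: add_continuous.
Qed.

Lemma clin_sub (E F : tvsType K) (f g : E -> F) :
  clin f -> clin g -> clin (fun x => f x - g x).
Proof.
move=> [lf cf] [lg cg]; split=> [a x y|x].
  by rewrite lf lg scalerBr opprD addrACA.
apply: (@continuous_comp _ _ _ (fun x => (f x, g x)) (fun z => z.1 - z.2)).
  by apply: cvg_pair; [exact: cf|exact: cg].
exact: sub_continuous.
Qed.

Lemma clin_iso (E F : tvsType K) (f : E -> F) (g : F -> E) :
  clin f -> clin g -> cancel f g -> cancel g f -> tvs_iso E F.
Proof.
move=> fl gl fg gf.
have [f' f'E] := clin_linear_fun fl; have [g' g'E] := clin_linear_fun gl.
have {}f'E : f' = f :> (E -> F) by apply/funext.
have {}g'E : g' = g :> (F -> E) by apply/funext.
exists f', g'; rewrite f'E g'E; split=> //; [exact: fl.2|exact: gl.2].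
Qed.

(** The retraction is the projection onto the copy of X followed by the inverse of the embedding. *)
Lemma complemented_in_clin (X Y : tvsType K) : complemented_in X Y ->
  exists i : X -> Y, exists r : Y -> X, [/\ clin i, clin r & cancel i r].
Proof.
move=> [F [P [cP PP PF]] [f [g [cf fF fg cg]]]].
have FP y : F (P y) by rewrite -PF; exists y.
have PK y : F y -> P y = y by rewrite -PF => -[z _ <-]; exact: PP.
have gK y : F y -> f (g y) = y by rewrite -fF => -[x _ <-]; rewrite fg.
exists f, (fun y => g (P y)); split; first exact: linear_clin.
- split=> [a x y|y].
    (* [g] is not given as linear; on [F] it inherits linearity from the injective map [f]. *)
    rewrite linearP; apply: (can_inj fg).
    rewrite [RHS]linearP (gK (P x))// (gK (P y))// gK//.
    by rewrite -linearP; exact: FP.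
  (* [g] is continuous only for the subspace topology of [F], but all values of [P] lie in [F]. *)
  move=> U gU; have /cP gPU : within F (nbhs (P y)) (g @^-1` U).
    by rewrite (nbhs_subspace_in (FP y)); exact: cg.
  by apply: (@filterS _ (nbhs y) _ _ _ _ gPU) => z; apply; exact: FP.
- by move=> x; rewrite PK ?fg// -fF; exists x.
Qed.

End ContinuousLinear.

(** * The swindle, carried through Schanuel's argument *)

Section Swindle.
Context {K : numFieldType} (E X : tvsType K).
Variables (i : X -> E) (r : E -> X) (i' : E -> X) (r' : X -> E).
Variables (s0 s1 t0 t1 S : E -> E) (q : nat -> E -> E).
Hypotheses (il : clin i) (rl : clin r) (ir : cancel i r).
Hypotheses (i'l : clin i') (r'l : clin r') (ir' : cancel i' r').
Hypotheses (s0l : clin s0) (s1l : clin s1) (t0l : clin t0) (t1l : clin t1).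
Hypotheses (t0s0 : forall x, t0 (s0 x) = x) (t0s1 : forall x, t0 (s1 x) = 0).
Hypotheses (t1s0 : forall x, t1 (s0 x) = 0) (t1s1 : forall x, t1 (s1 x) = x).
Hypothesis stD : forall x, s0 (t0 x) + s1 (t1 x) = x.
Hypotheses (Sl : clin S) (ql : forall k, clin (q k)).
Hypotheses (Sinj : injective S) (qS : forall k x, q k (S x) = 0).
Hypothesis ker_factor : forall W : E -> E, clin W ->
  (forall k x, q k (W x) = 0) -> exists2 W', clin W' & forall x, S (W' x) = W x.
Hypothesis lift : forall T : nat -> E -> E, (forall k, clin (T k)) ->
  exists2 T', clin T' & forall k x, q k (T' x) = T k x.


(* Let P = i r and Q = 1 - P. With U (x_k)_k = (P x_(k+1) + Q x_k)_k and its
   right inverse V (x_k)_k = (P x_(k-1) + Q x_k)_k, the kernel of U is X in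
   position 0, so G := ker (U q) is X + ker q. Pulling q and U q back along each other
   (Schanuel) gives E + ker q = E + G, and S identifies ker q with E. *)
Lemma swindle : tvs_iso X E.
Proof.
have [P PE] : exists P, forall x, P x = i (r x) by exists (i \o r).
have [Q QE] : exists Q, forall x, Q x = x - P x by exists (fun x => x - P x).
have Pl : clin P by rewrite (funext PE); exact: clin_comp.
have Ql : clin Q.
  by rewrite (funext QE); apply: clin_sub => //; exact: clin_id.
have PP x : P (P x) = P x by rewrite !PE ir.
have PQ x : P (Q x) = 0 by rewrite QE (clinB Pl) PP subrr.
have QP x : Q (P x) = 0 by rewrite QE PP subrr.
have QQ x : Q (Q x) = Q x by rewrite {1}QE PQ subr0.
have PDQ x : P x + Q x = x by rewrite QE addrC subrK.
have decomp u v : P u + Q v = 0 -> P u = 0 /\ Q v = 0.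
  move=> e; have := congr1 P e; rewrite (clinD Pl) PP PQ addr0 (clin0 Pl) => p0.
  by split=> //; move: e; rewrite p0 add0r.
(* With U and V as above, [A] lifts V q, [B] lifts U q, and [C] lifts x |-> (P x, 0, 0, ...). *)
have [A Al qA] : exists2 A, clin A & forall k x,
    q k (A x) = (if k is k'.+1 then P (q k' x) else 0) + Q (q k x).
  apply: (lift (T := fun k x => _ + Q (q k x))) => k.
  apply: clin_add; last exact: (clin_comp Ql).
  by case: k => [|k]; [exact: clin_cst0|exact: (clin_comp Pl)].
have [B Bl qB] : exists2 B, clin B & forall k x,
    q k (B x) = P (q k.+1 x) + Q (q k x).
  apply: (lift (T := fun k x => P (q k.+1 x) + Q (q k x))) => k.
  by apply: clin_add; [exact: (clin_comp Pl)|exact: (clin_comp Ql)].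
have [C Cl qC] : exists2 C, clin C & forall k x,
    q k (C x) = if k is 0 then P x else 0.
  apply: (lift (T := fun k x => if k is 0 then P x else 0)) => -[//|k].
  exact: clin_cst0.
(* U V = 1, read on q x. *)
have UqA k x : P (q k.+1 (A x)) + Q (q k (A x)) = q k x.
  rewrite !qA !(clinD Pl) !(clinD Ql) PP PQ addr0 QQ.
  by case: k => [|k]; rewrite ?(clin0 Ql) ?QP ?add0r PDQ.
(* The maps 1 - B A, B C and B S take values in ker q, hence factor through [S]. *)
have [A' A'l SA'] : exists2 A', clin A' & forall x, S (A' x) = x - B (A x).
  apply: ker_factor => [|k x].
    by apply: clin_sub; [exact: clin_id|exact: (clin_comp Bl)].
  by rewrite (clinB (ql k)) qB UqA subrr.
have [C' C'l SC'] : exists2 C', clin C' & forall x, S (C' x) = B (C x).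
  apply: ker_factor => [|k x]; first exact: (clin_comp Bl).
  by rewrite qB !qC (clin0 Pl) add0r; case: k; rewrite ?QP ?(clin0 Ql).
have [B' B'l SB'] : exists2 B', clin B' & forall x, S (B' x) = B (S x).
  apply: ker_factor => [|k x]; first exact: (clin_comp Bl).
  by rewrite qB !qS (clin0 Pl) (clin0 Ql) addr0.
(* The pullback consists of the pairs (a, b) with q a = U q b. To e it assigns b = t1 e and a =
   [a_ e]; [d_ e] is the part of b in ker (U q), and [W e] is what this leaves in ker q once its
   X-component is removed. *)
pose a_ e := B (t1 e) + S (t0 e).
pose d_ e := t1 e - A (a_ e).
pose W e := d_ e - C (P (q 0 (d_ e))).
have al : clin a_ := clin_add (clin_comp Bl t1l) (clin_comp Sl t0l).
have dl : clin d_ := clin_sub t1l (clin_comp Al al).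
have qdl := clin_comp (ql 0) dl.
(* U q (d_ e) = 0: hence q (d_ e) sits in position 0, with values in the range of [P]. *)
have qd k e : P (q k.+1 (d_ e)) = 0 /\ Q (q k (d_ e)) = 0.
  apply: decomp; rewrite !(clinB (ql _)) (clinB Pl) (clinB Ql) addrACA -opprD.
  by rewrite UqA -qB -(clinB (ql _)) /a_ opprD addrA subrr add0r -sub0r
    (clinB (ql _)) qS (clin0 (ql _)) subrr.
have [Z Zl SZ] : exists2 Z, clin Z & forall x, S (Z x) = W x.
  apply: ker_factor => [|k x].
    by apply: clin_sub => //; apply: (clin_comp Cl); exact: (clin_comp Pl).
  rewrite (clinB (ql _)) qC PP.
  case: k => [|k]; first by rewrite -QE (qd 0%N x).2.
  have [Pk _] := qd k x; have [_ Qk] := qd k.+1 x.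
  by rewrite subr0 -[LHS]PDQ Pk Qk addr0.
(* X = ker r' + E and E = E + E give X = X + E: [xi] replaces the component r' x by its half t0,
   [la] extracts the half t1, and [xl] is the inverse. *)
pose xi x := x - i' (r' x) + i' (t0 (r' x)).
pose la x := t1 (r' x).
have xil : clin xi.
  apply: clin_add (clin_comp i'l (clin_comp t0l r'l)).
  exact: clin_sub (@clin_id _ _) (clin_comp i'l r'l).
have lal : clin la := clin_comp t1l r'l.
pose xl (v : X) (l : E) := v - i' (r' v) + i' (s0 (r' v) + s1 l).
have xlK x : xl (xi x) (la x) = x.
  have r'xi : r' (xi x) = t0 (r' x).
    by rewrite /xi (clinD r'l) (clinB r'l) !ir' subrr add0r.
  by rewrite /xl r'xi /la stD /xi addrK subrK.
have r'xl v l : r' (xl v l) = s0 (r' v) + s1 l.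
  by rewrite /xl (clinD r'l) (clinB r'l) !ir' subrr add0r.
have xiK v l : xi (xl v l) = v.
  by rewrite /xi r'xl (clinD t0l) t0s0 t0s1 addr0 /xl addrK subrK.
have laK v l : la (xl v l) = l.
  by rewrite /la r'xl (clinD t1l) t1s0 t1s1 add0r.
(* The pullback from its other side: a = t0 (la x), and b = [b_ x] is A a plus an element of ker (U
   q) = X + ker q. Then [y_ x] is the preimage of a - B b under [S]. *)
pose b_ x := A (t0 (la x)) + C (i (xi x)) + S (t1 (la x)).
pose y_ x := A' (t0 (la x)) - C' (i (xi x)) - B' (t1 (la x)).
pose f x := s0 (y_ x) + s1 (b_ x).
have bl : clin b_.
  apply: clin_add (clin_comp Sl (clin_comp t1l lal)).
  exact: clin_add (clin_comp Al (clin_comp t0l lal))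
    (clin_comp Cl (clin_comp il xil)).
have yl : clin y_.
  apply: clin_sub (clin_comp B'l (clin_comp t1l lal)).
  exact: clin_sub (clin_comp A'l (clin_comp t0l lal))
    (clin_comp C'l (clin_comp il xil)).
have Sy x : S (y_ x) = t0 (la x) - B (b_ x).
  rewrite /y_ !(clinB Sl) SA' SC' SB' /b_ !(clinD Bl).
  by rewrite !opprD !addrA.
pose g e := xl (r (q 0 (d_ e))) (s0 (a_ e) + s1 (Z e)).
have t0f x : t0 (f x) = y_ x by rewrite /f (clinD t0l) t0s0 t0s1 addr0.
have t1f x : t1 (f x) = b_ x by rewrite /f (clinD t1l) t1s0 t1s1 add0r.
apply: (@clin_iso _ _ _ f g).
- exact: clin_add (clin_comp s0l yl) (clin_comp s1l bl).
- have vl := clin_comp rl qdl.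
  have ll := clin_add (clin_comp s0l al) (clin_comp s1l Zl).
  apply: clin_add (clin_sub vl (clin_comp i'l (clin_comp r'l vl))) _.
  apply: clin_comp i'l (clin_add _ (clin_comp s1l ll)).
  exact: clin_comp s0l (clin_comp r'l vl).
- move=> x.
  have af : a_ (f x) = t0 (la x) by rewrite /a_ t0f t1f Sy addrC subrK.
  have df : d_ (f x) = C (i (xi x)) + S (t1 (la x)).
    by rewrite /d_ t1f af /b_ -[X in X - _]addrA [X in X - _]addrC addrK.
  have q0d : q 0 (d_ (f x)) = i (xi x).
    by rewrite df (clinD (ql _)) qS qC addr0 PE ir.
  have Zf : Z (f x) = t1 (la x).
    by apply: Sinj; rewrite SZ /W q0d df PE ir addrAC subrr add0r.
  by rewrite /g q0d ir af Zf stD xlK.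
- move=> e; have q0d : P (q 0 (d_ e)) = q 0 (d_ e).
    by rewrite -[RHS]PDQ (qd 0%N e).2 addr0.
  have la_g : la (g e) = s0 (a_ e) + s1 (Z e) by rewrite laK.
  have t0la : t0 (la (g e)) = a_ e by rewrite la_g (clinD t0l) t0s0 t0s1 addr0.
  have t1la : t1 (la (g e)) = Z e by rewrite la_g (clinD t1l) t1s0 t1s1 add0r.
  have bg : b_ (g e) = t1 e.
    rewrite /b_ t0la t1la SZ /W xiK -PE.
    by rewrite -addrA [C _ + _]addrC subrK addrC subrK.
  have yg : y_ (g e) = t0 e.
    by apply: Sinj; rewrite Sy t0la bg /a_ addrC addKr.
  by rewrite /f bg yg stD.
Qed.

End Swindle.

(** * Coefficient bounds and neighbourhoods of 0 *)

Section Coefficients.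
Context {R : realType} {alpha beta : exponent_sequence R}.
Local Notation L := (Lambda_infty alpha beta).
Local Notation normc := Normc.normc.
Implicit Types (c d : nat * nat -> R[i]) (n N : nat).

(** The inequality wnorm <= M with the weight moved to the right, so that estimates stay in the
    reals and only multiply exponentials. *)
Definition bnd n N c (M : R) := forall i j,
  normc (c (i, j)) <= M * expR (N%:R * beta j - n%:R * alpha i).

Lemma bndP n N c M : bnd n N c M <-> (wnorm alpha beta n N c <= M%:E)%E.
Proof.
have wE i j : weight alpha beta n N (i, j) =
    (expR (N%:R * beta j - n%:R * alpha i))^-1.
  by rewrite -expRN opprB.
split=> [h|h i j].
  apply: ge_ereal_sup => _ [[i j] _ <-].
  by rewrite lee_fin wE ler_pdivrMr ?expR_gt0.
have := le_trans (wnorm_ub alpha beta n N c (i, j)) h.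
by rewrite lee_fin wE ler_pdivrMr ?expR_gt0.
Qed.

Lemma bnd_ge0 n N c M : bnd n N c M -> 0 <= M.
Proof.
by move=> /(_ 0 0)%N /(le_trans (normc_ge0 _)); rewrite pmulr_lge0 ?expR_gt0.
Qed.

Lemma bnd_fin n N c : (exists M, bnd n N c M) <->
  (wnorm alpha beta n N c < +oo)%E.
Proof.
split=> [[M /bndP h]|h]; first by rewrite (le_lt_trans h) ?ltry.
exists (fine (wnorm alpha beta n N c)); apply/bndP.
by rewrite fineK// ge0_fin_numE ?wnorm_ge0.
Qed.

Lemma bnd_le n N c (M M' : R) : M <= M' -> bnd n N c M -> bnd n N c M'.
Proof.
by move=> MM' h i j; apply: (le_trans (h i j)); rewrite ler_wpM2r ?expR_ge0.
Qed.

Lemma bnd_weak n n' N N' c M : (n <= n')%N -> (N' <= N)%N ->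
  bnd n' N' c M -> bnd n N c M.
Proof.
move=> nn NN h i j; apply: (le_trans (h i j)).
rewrite ler_wpM2l ?(bnd_ge0 h)// ler_expR lerB// ler_wpM2r ?ler_nat//;
  exact/ltW/expseq_gt0.
Qed.

Lemma bndZ n N c M (a : R[i]) : bnd n N c M -> bnd n N (a *: c) (normc a * M).
Proof.
move=> h i j; rewrite [(_ *: _) _]/(a * _) Normc.normcM -mulrA.
by rewrite ler_wpM2l ?normc_ge0.
Qed.

Lemma bnd_le_coef n N c d (M : R) :
  (forall ij, normc (d ij) <= normc (c ij)) -> bnd n N c M -> bnd n N d M.
Proof. by move=> cd h i j; apply: le_trans (h i j); exact: cd. Qed.

Definition lcoef (x : L) : nat * nat -> R[i] :=
  @submod_val _ _ _ x.

Lemma lcoefP a x y ij : lcoef (a *: x + y) ij = a * lcoef x ij + lcoef y ij.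
Proof. by []. Qed.

Lemma lcoefZ a x ij : lcoef (a *: x) ij = a * lcoef x ij.
Proof. by []. Qed.

Lemma lcoefD x y ij : lcoef (x + y) ij = lcoef x ij + lcoef y ij.
Proof. by []. Qed.

Lemma lcoefB x y ij : lcoef (x - y) ij = lcoef x ij - lcoef y ij.
Proof. by []. Qed.

Lemma lcoef0 ij : lcoef 0 ij = 0. Proof. by []. Qed.

Lemma lcoef_inj x y : lcoef x =1 lcoef y -> x = y.
Proof. by move=> /funext xy; apply/val_inj. Qed.

Lemma lcoef_bnd x n : exists N M, bnd n N (lcoef x) M.
Proof.
have /asboolP/(_ n)[N /bnd_fin[M h]] := @submod_valP _ _ _ x.
by exists N, M.
Qed.

Lemma lcoef_surj c : (forall n, exists N M, bnd n N c M) ->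
  exists x, lcoef x = c.
Proof.
move=> h; have cl : c \in lambda_pred alpha beta.
  by apply/asboolP => n; have [N [M ?]] := h n; exists N; apply/bnd_fin; exists M.
by exists (Submod cl : L).
Qed.

Section StepNeighbourhoods.
Variable n : nat.
Local Notation LBn := (LB_space alpha beta n).

Definition ucoef (x : LBn) : nat * nat -> R[i] :=
  @submod_val _ _ _ x.

Lemma ucoefP a x y ij : ucoef (a *: x + y) ij = a * ucoef x ij + ucoef y ij.
Proof. by []. Qed.

Lemma ucoefZ a x : ucoef (a *: x) = a *: ucoef x.
Proof. by []. Qed.

Lemma ucoef_bnd x : exists N M, bnd n N (ucoef x) M.
Proof.
have /asboolP[N /bnd_fin[M h]] := @submod_valP _ _ _ x.
by exists N, M.
Qed.

Lemma ucoef_incl (x : L) : ucoef (lambda_incl alpha beta n x) = lcoef x.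
Proof. by []. Qed.

Let real_part_gt0 (e : R[i]) : 0 < e -> exists2 r : R, 0 < r & e = r%:C%C.
Proof. by case: e => a b; rewrite ltcE /= => /andP[/eqP -> a0]; exists a. Qed.

(** Absorption follows from the balls, since every x lies in some step. *)
Lemma LB_nbhs0 (U : set LBn) : absolutely_convex U ->
  (forall N, exists2 e : R, 0 < e & forall x, bnd n N (ucoef x) e -> U x) ->
  nbhs 0 U.
Proof.
move=> acU h; rewrite lc_final_nbhs0E; exists U; split=> //.
- move=> x; have [N [M xM]] := ucoef_bnd x; have [e e0 eU] := h N.
  have M0 := bnd_ge0 xM; have M1 : 0 < M + 1 by rewrite ltr_wpDl.
  exists (e / (M + 1))%:C%C; first by rewrite ltcR divr_gt0.
  move=> a ae; apply: eU; rewrite ucoefZ; apply: bnd_le (bndZ a xM).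
  have : normc a <= e / (M + 1) by rewrite -lecR.
  rewrite ler_pdivlMr// => aM; apply: le_trans aM.
  by rewrite ler_wpM2l ?normc_ge0// lerDl.
- move=> N; have [e e0 eU] := h N; apply/nbhs_ballP.
  exists e%:C%C; first by rewrite /= ltcR.
  move=> x; rewrite -ball_normE /= sub0r normrN => xe; apply: eU.
  apply/bndP; rewrite -(fineK (wsup_fin x)) lee_fin ltW//.
  by rewrite -ltcR.
Qed.

Lemma LB_nbhs0_ball (U : set LBn) : nbhs 0 U -> exists V : set LBn,
  [/\ absolutely_convex V, V `<=` U &
    forall N, exists2 e : R, 0 < e & forall x, bnd n N (ucoef x) e -> V x].
Proof.
rewrite lc_final_nbhs0E => -[V [acV _ NV VU]]; exists V; split=> // N.
have /nbhs_ballP[_ /= /real_part_gt0[e e0 ->] eV] := NV N.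
(* Half the radius, because [bnd] is a weak inequality and the norm ball is open. *)
exists (e / 2); first by rewrite divr_gt0.
move=> x xe.
have xN : ucoef x \in wsup_pred alpha beta n N.
  by apply/asboolP/bnd_fin; exists (e / 2).
have := eV (Submod xN); rewrite -ball_normE /= sub0r normrN.
rewrite (_ : wsup_incl _ _ _ _ _ = x); last exact/val_inj.
apply; rewrite [`|_|]/(wsup_norm _) ltcR.
apply: (@le_lt_trans _ _ (e / 2)); last by rewrite ltr_pdivrMr// ltr_pMr// ltr1n.
by rewrite -lee_fin fineK ?wsup_fin//; apply/bndP.
Qed.

End StepNeighbourhoods.

(** A neighbourhood involves finitely many levels, and the norms increase with n, so the largest
    level serves for all [N]. *)
Lemma L_nbhs0_ball (U : set L) : nbhs 0 U -> exists n, forall N,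
  exists2 e : R, 0 < e & forall x, bnd n N (lcoef x) e -> U x.
Proof.
rewrite lc_initial_nbhs0E => -[s [W [NW WU]]].
exists (\max_(i <- s) i)%N => N.
suff [e e0 h] : exists2 e : R, 0 < e &
    forall x, bnd (\max_(i <- s) i)%N N (lcoef x) e ->
    forall i, i \in s -> W i (lambda_incl alpha beta i x).
  by exists e => // x /h xW; exact: WU.
elim: s {WU} => [|i s [e e0 h]]; first by exists 1.
have [V [_ VW /(_ N)[r r0 rV]]] := LB_nbhs0_ball (NW i).
exists (Num.min e r); first by rewrite lt_min e0 r0.
rewrite big_cons => x xe k; rewrite in_cons => /predU1P[->|ks].
  apply/VW/rV; rewrite ucoef_incl.
  by apply: bnd_weak (bnd_le _ xe); rewrite ?leq_maxl ?ge_min ?lexx ?orbT.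
apply: h => //.
by apply: bnd_weak (bnd_le _ xe); rewrite ?leq_maxr ?ge_min ?lexx ?orbT.
Qed.

Lemma L_nbhs0_LB n (V : set (LB_space alpha beta n)) : nbhs 0 V ->
  nbhs (0 : L) [set x | V (lambda_incl alpha beta n x)].
Proof.
move=> NV.
have : continuous (@idfun L : {linear L -> L}) by move=> x; exact: cvg_id.
move=> /lc_initial_continuousP/(_ n 0 V); rewrite /= linear0; exact.
Qed.

End Coefficients.

(** * Exponent sequences and condition (N) *)

Section ExponentSequences.
Context {R : realType}.
Implicit Types a : exponent_sequence R.

Lemma expseq_le a i j : (i <= j)%N -> a i <= a j.
Proof. exact: expseq_nd. Qed.

Lemma expseq_unbounded a (A : R) : exists i, A <= a i.
Proof.
have /cvgryPge/(_ A)[i _ h] := @expseq_pinfty R a.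
by exists i; apply: h => /=.
Qed.

(** An integer constant can be added to the indices n and N. *)
Lemma condition_N_nat a : condition_N a ->
  exists c : nat, forall i, 1 + i%:R <= expR (c%:R * a i) :> R.
Proof.
rewrite /condition_N => Ha.
have ub i := @ereal_sup_ubound R _ _ (imageT (fun i => (ln (1 + i%:R) / a i)%:E) i).
have [M hM] : exists M : R, forall i, ln (1 + i%:R) / a i <= M.
  move: Ha ub; case: ereal_sup => [M _ ub|//|_ ub].
    by exists M => i; rewrite -lee_fin.
  by have := ub 0%N; rewrite leeNy_eq.
exists (Num.truncn M).+1 => i.
rewrite -[leLHS](@lnK R) ?posrE ?ltr_wpDr// ler_expR.
have := hM i; rewrite ler_pdivrMr ?expseq_gt0// => /le_trans; apply.
rewrite ler_wpM2r ?(ltW (expseq_gt0 _ _))//.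
exact/ltW/truncnS_gt.
Qed.

End ExponentSequences.

Lemma seq_lower_bound (R : realType) (f : nat -> R) n : (forall k, 0 < f k) ->
  exists2 e : R, 0 < e & forall k, (k < n)%N -> e <= f k.
Proof.
move=> f0; elim: n => [|n [e e0 ef]]; first by exists 1.
exists (Num.min e (f n)); first by rewrite lt_min e0 f0.
move=> k; rewrite ltnS leq_eqVlt => /predU1P[->|/ef kf].
  by rewrite ge_min lexx orbT.
by rewrite ge_min kf.
Qed.

(** * Absolutely convex sets *)

Section AbsolutelyConvexSets.
Context {R : realType}.
Local Notation normc := Normc.normc.

Lemma normc_real (r : R) : normc (r%:C%C) = `|r|.
Proof. by rewrite /normc /= expr0n addr0 sqrtr_sqr. Qed.

Lemma normc_real_ge0 (r : R) : 0 <= r -> normc (r%:C%C) = r.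
Proof. by move=> r0; rewrite normc_real ger0_norm. Qed.

Lemma normc_nat n : normc (n%:R : R[i]) = n%:R.
Proof. by rewrite -(rmorph_nat (real_complex R)) normc_real_ge0. Qed.

Lemma normc_sum_convex (t : R[i]) : 0 <= t -> t <= 1 ->
  normc t + normc (1 - t) = 1.
Proof.
move=> t0; have [a a0 ->] : exists2 a : R, 0 <= a & t = a%:C%C.
  by case: t t0 => a b; rewrite lecE /= => /andP[/eqP -> a0]; exists a.
rewrite -(rmorph1 (real_complex R)) -rmorphB !lecR => a1.
rewrite (normc_real_ge0 a0) normc_real_ge0 ?subr_ge0//.
by rewrite addrC subrK.
Qed.

Lemma coordinates_acx (E : lmodType R[i]) (T I : Type) (F : E -> T -> R[i])
    (p : I -> T) (w : I -> R) :
  (forall (a : R[i]) x y t, F (a *: x + y) t = a * F x t + F y t) ->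
  absolutely_convex [set x | forall k, normc (F x (p k)) <= w k].
Proof.
move=> FP.
have F0 t : F 0 t = 0.
  by have /eqP := FP 1 0 0 t; rewrite scaler0 addr0 mul1r -subr_eq0 opprD addrA
    subrr sub0r oppr_eq0 => /eqP.
have FZ a x t : F (a *: x) t = a * F x t.
  by have := FP a x 0 t; rewrite addr0 F0 addr0.
split.
  apply/convex_setP => x y t t0 t1 xw yw k; rewrite FP FZ.
  rewrite (le_trans (le_normcD _ _))// !Normc.normcM.
  rewrite -[leRHS]mul1r -(normc_sum_convex t0 t1) mulrDl.
  by rewrite lerD// ler_wpM2l ?normc_ge0.
move=> a x a1 xw k; rewrite FZ Normc.normcM.
have {}a1 : normc a <= 1 by rewrite -lecR.
by rewrite (le_trans _ (xw k))// ler_piMl ?normc_ge0.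
Qed.

(** By induction the sum is its total weight times a point of [V]; balancedness absorbs a total
    below 1. *)
Lemma acx_sum (E : lmodType R[i]) (V : set E) (z : nat -> E) (t : nat -> R) n :
  absolutely_convex V -> V 0 -> (forall k, V (z k)) -> (forall k, 0 <= t k) ->
  \sum_(k < n) t k <= 1 -> V (\sum_(k < n) (t k)%:C%C *: z k).
Proof.
move=> [/convex_setP cV bV] V0 Vz t0 s1.
suff [y Vy ->] : exists2 y, V y &
    \sum_(k < n) (t k)%:C%C *: z k = (\sum_(k < n) t k)%:C%C *: y.
  apply: bV => //; rewrite [`|_|]/(normc _)%:C%C lecR.
  by rewrite normc_real_ge0 ?sumr_ge0.
elim: n {s1} => [|n [y Vy yE]]; first by exists 0; rewrite // !big_ord0 scaler0.
rewrite !big_ord_recr /= yE.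
set s := \sum_(k < n) t k; have s0 : 0 <= s by exact: sumr_ge0.
have [st0|st0] := eqVneq (s + t n) 0.
  have /andP[/eqP -> /eqP ->] : (s == 0) && (t n == 0) by rewrite -paddr_eq0 ?st0.
  by exists 0; rewrite // addr0 !scale0r addr0.
have st : 0 < s + t n by rewrite lt_def st0 addr_ge0.
exists ((s / (s + t n))%:C%C *: y + (1 - (s / (s + t n))%:C%C) *: z n).
  apply: cV => //; rewrite ?lecR ?divr_ge0//; first exact: ltW.
  by rewrite ler_pdivrMr// mul1r lerDl.
rewrite scalerDr !scalerA mulrBr mulr1 -!rmorphM -!rmorphB /=.
by rewrite mulrCA divff// mulr1 [s + _]addrC addrK.
Qed.

End AbsolutelyConvexSets.

(** * Continuity of operators as estimates *)

Section ContinuousOperators.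
Context {R : realType} {alpha beta : exponent_sequence R}.
Local Notation L := (Lambda_infty alpha beta).
Local Notation normc := Normc.normc.
Implicit Types (x y : L) (n N m M : nat).
Local Notation bnd := (@bnd R alpha beta).

Lemma restr_subproof (D : nat * nat -> bool) x :
  exists y : L, lcoef y = (fun ij => if D ij then lcoef x ij else 0).
Proof.
apply: lcoef_surj => n; have [N [M h]] := lcoef_bnd x n; exists N, M.
by apply: bnd_le_coef h => ij; case: ifP; rewrite // Normc.normc0 normc_ge0.
Qed.

Definition restr D x : L := sval (cid (restr_subproof D x)).

Lemma lcoef_restr D x ij : lcoef (restr D x) ij = if D ij then lcoef x ij else 0.
Proof. by rewrite /restr; case: cid => y /= ->. Qed.

Lemma restrP D a x y : restr D (a *: x + y) = a *: restr D x + restr D y.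
Proof.
apply: lcoef_inj => ij; rewrite lcoefP !lcoef_restr.
by case: (D ij); rewrite ?lcoefP// mulr0 addr0.
Qed.

Lemma bnd_restr n N D x (K : R) :
  bnd n N (lcoef x) K -> bnd n N (lcoef (restr D x)) K.
Proof.
apply: bnd_le_coef => ij; rewrite lcoef_restr.
by case: ifP; rewrite // Normc.normc0 normc_ge0.
Qed.

Lemma lcoef_sum (I : Type) (r : seq I) (P : pred I) (F : I -> L) ij :
  lcoef (\sum_(k <- r | P k) F k) ij = \sum_(k <- r | P k) lcoef (F k) ij.
Proof. by apply: (big_morph (fun x => lcoef x ij)) => // x y. Qed.

Section Neighbourhoods.
Hypothesis betaN : condition_N beta.

(** The balls lie in L, whereas the topology comes from the larger space [LB_space m]. A
    neighbourhood [W] there, given by column bounds g_b t_b, has its trace on L inside [V]: such an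
    x is a finite combination of columns, rescaled into [V], plus a tail that is small in the next
    step. *)
Lemma L_nbhs0 (V : set L) m : absolutely_convex V ->
  (forall M, exists2 e : R, 0 < e & forall x, bnd m M (lcoef x) e -> V x) ->
  nbhs 0 V.
Proof.
move=> acV hV.
have [rho rhoP] : {rho : nat -> R & forall M, 0 < rho M /\
    forall x, bnd m M (lcoef x) (rho M) -> V x}.
  by apply: (@choice _ _ (fun M e => 0 < e /\ forall x, bnd m M (lcoef x) e -> V x))
    => M; have [e e0 eV] := hV M; exists e.
have rho0 M : 0 < rho M by case: (rhoP M).
have rhoV M x : bnd m M (lcoef x) (rho M) -> V x by case: (rhoP M) => _; exact.
have V0 : V 0.
  apply: (rhoV 0%N) => i j.
  by rewrite lcoef0 Normc.normc0 mulr_ge0 ?expR_ge0// ltW.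
(* [g b] dominates the terms with [M <= b], which puts balls into [W], and is itself one of the
   terms, which puts each rescaled column into a single ball. *)
have [g gP] : {g : nat -> R & forall b,
    (forall M, (M <= b)%N -> rho M * expR (M%:R * beta b) <= g b) /\
    exists M, g b = rho M * expR (M%:R * beta b)}.
  apply: (@choice _ _ (fun b g =>
    (forall M, (M <= b)%N -> rho M * expR (M%:R * beta b) <= g) /\
    exists M, g = rho M * expR (M%:R * beta b))) => b.
  suff : forall n, exists g, (forall M, (M <= n)%N ->
      rho M * expR (M%:R * beta b) <= g) /\
      exists M, g = rho M * expR (M%:R * beta b) by apply.
  elim=> [|n [g [gM [M0 gE]]]].
    exists (rho 0%N * expR (0%:R * beta b)); split; last by exists 0%N.
    by move=> M; rewrite leqn0 => /eqP ->.
  have [le|le] := leP (rho n.+1 * expR (n.+1%:R * beta b)) g.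
    exists g; split; last by exists M0.
    by move=> M; rewrite leq_eqVlt => /predU1P[->//|]; exact: gM.
  exists (rho n.+1 * expR (n.+1%:R * beta b)); split; last by exists n.+1.
  move=> M; rewrite leq_eqVlt => /predU1P[->//|Mn].
  by apply: le_trans (gM _ Mn) _; exact: ltW.
have g0 b : 0 < g b.
  by have [_ [M ->]] := gP b; rewrite mulr_gt0 ?expR_gt0.
(* Telescoping weights, halved to make room for the factor 2 of [acx_half]; by (N) they decay no
   faster than exp(-2c beta_b). *)
pose t b : R := (b.+1%:R^-1 - b.+2%:R^-1) / 2.
have t0 b : 0 < t b.
  by rewrite divr_gt0// subr_gt0 ltf_pV2 ?posrE ?ltr_nat.
have tsum B : \sum_(b < B) (t b *+ 2) <= 1.
  rewrite (eq_bigr (fun b : 'I_B => b.+1%:R^-1 - b.+2%:R^-1)); last first.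
    by move=> b _; rewrite /t mulr2n -splitr.
  rewrite -(big_mkord xpredT (fun b => b.+1%:R^-1 - b.+2%:R^-1)).
  under eq_bigr do rewrite -opprB.
  rewrite sumrN telescope_sumr// opprB invr1.
  by rewrite gerBl invr_ge0 ler0n.
have [c cP] := condition_N_nat betaN.
have tge b : expR (- (2 * c)%:R * beta b) / 4 <= t b.
  have b1 : b.+1%:R <= expR (c%:R * beta b) :> R.
    by have := cP b; rewrite nat1r.
  have tE : t b = (2 * b.+1%:R * b.+2%:R)^-1.
    rewrite /t -[b.+2%:R]natr1.
    have : 0 < b.+1%:R :> R by rewrite ltr0n.
    move: (b.+1%:R : R) => u u0.
    have u1 : u + 1 != 0 by rewrite gt_eqF// ltr_wpDl// ltW.
    have {}u0 : u != 0 by rewrite gt_eqF.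
    by field; rewrite u0 u1.
  have e4 : (expR ((2 * c)%:R * beta b) * 4)^-1 =
    expR (- (2 * c)%:R * beta b) / 4 by rewrite invfM mulNr expRN.
  rewrite tE -e4 lef_pV2 ?posrE ?mulr_gt0 ?expR_gt0//.
  have -> : expR ((2 * c)%:R * beta b) =
      expR (c%:R * beta b) * expR (c%:R * beta b).
    by rewrite -expRD natrM; congr expR; ring.
  have b2 : b.+2%:R <= 2 * b.+1%:R :> R.
    by rewrite -natrM ler_nat mulnS mul2n -addnn add2n !ltnS leq_addl.
  have b0 : 0 <= b.+1%:R :> R by [].
  nra.
pose W : set (LB_space alpha beta m) :=
  [set x | forall ij : nat * nat,
    normc (ucoef x ij) <= g ij.2 * t ij.2 * expR (- (m%:R * alpha ij.1))].
have NW : nbhs 0 W.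
  apply: LB_nbhs0.
    exact: (@coordinates_acx _ _ _ _ (@ucoef R alpha beta m) id _
      (@ucoefP _ _ _ _)).
  (* The 2c extra steps pay for t_b on the columns b >= M; the finitely many others only bound the
     radius. *)
  move=> N; pose M := (N + 2 * c)%N.
  have [e e0 eP] := @seq_lower_bound R
    (fun b => g b * t b * expR (- (N%:R * beta b))) M
    (fun b => mulr_gt0 (mulr_gt0 (g0 b) (t0 b)) (expR_gt0 _)).
  exists (Num.min e (rho M / 4)); first by rewrite lt_min e0 divr_gt0.
  move=> x xe [a b] /=; apply: (le_trans (xe a b)).
  rewrite expRD mulrA ler_wpM2r ?expR_ge0// -ler_pdivlMr ?expR_gt0// -expRN.
  have [bM|Mb] := ltnP b M; first by rewrite ge_min eP.
  rewrite ge_min; apply/orP; right.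
  have gM := (gP b).1 M Mb.
  have -> : rho M / 4 = rho M * expR (M%:R * beta b) *
      (expR (- (2 * c)%:R * beta b) / 4) * expR (- (N%:R * beta b)).
    rewrite -[RHS]mulrA [_ / 4 * _]mulrAC !mulrA -[_ * _ * expR _]mulrA -expRD.
    rewrite -[_ * _ * expR _]mulrA -expRD.
    rewrite (_ : _ + _ = 0) ?expR0 ?mulr1// /M natrD; ring.
  rewrite ler_wpM2r ?expR_ge0//; apply: ler_pM => //.
  by rewrite mulr_ge0 ?expR_ge0// ltW.
apply: filterS (L_nbhs0_LB NW) => x /= xW.
have [M0 [K xK]] := lcoef_bnd x m.
have K0 := bnd_ge0 xK.
(* Going from step M0 to M0 + 1 gains exp(-beta_B) on the columns from [B] on, enough to beat 2K. *)
have [B hB] := expseq_unbounded beta (ln ((2 * K + 1) / rho M0.+1)).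
have K1 : 0 < 2 * K + 1 by rewrite ltr_wpDl// mulr_ge0.
have eB : 2 * K * expR (- beta B) <= rho M0.+1.
  have : (2 * K + 1) / rho M0.+1 <= expR (beta B).
    by rewrite -[leLHS](@lnK R) ?posrE ?divr_gt0// ler_expR.
  rewrite ler_pdivrMr// => h; rewrite expRN ler_pdivrMr ?expR_gt0//.
  by rewrite [leRHS]mulrC; apply: le_trans h; rewrite lerDl.
pose y b := restr (fun ij => ij.2 == b) x.
pose tail := restr (fun ij => (B <= ij.2)%N) x.
have xE : x = \sum_(b < B) y b + tail.
  apply: lcoef_inj => -[a b]; rewrite lcoefD lcoef_sum lcoef_restr /=.
  have [bB|Bb] := ltnP b B.
    rewrite addr0 (bigD1 (Ordinal bB))//= lcoef_restr eqxx big1 ?addr0// => k kb.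
    by rewrite lcoef_restr /= ifN// eq_sym; apply: contra kb => /eqP kb;
      exact/eqP/val_inj.
  rewrite big1 ?add0r// => k _; rewrite lcoef_restr /= ifN//.
  by rewrite gtn_eqF// (leq_trans (ltn_ord k)).
rewrite xE; apply: acx_half => //.
- pose z b := (t b)^-1%:C%C *: y b.
  have -> : 2 *: \sum_(b < B) y b = \sum_(b < B) (t b *+ 2)%:C%C *: z b.
    rewrite scaler_sumr; apply: eq_bigr => b _.
    by rewrite scalerA -rmorphM mulrnAl divff ?gt_eqF// rmorph_nat.
  apply: (@acx_sum _ _ V z (fun b => t b *+ 2)) => //; last first.
    by move=> b; rewrite mulrn_wge0// ltW.
  move=> b; have [_ [M gE]] := gP b; apply: (rhoV M) => a b'.
  rewrite lcoefZ Normc.normcM.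
  rewrite normc_real_ge0; last by rewrite invr_ge0 ltW.
  rewrite lcoef_restr /=.
  have [->|_] := eqVneq b' b; last first.
    by rewrite Normc.normc0 mulr0 mulr_ge0 ?expR_ge0// ltW.
  rewrite ler_pdivrMl// (le_trans (xW (a, b)))//= expRD mulrA -gE.
  by rewrite [t b * _]mulrA [t b * _]mulrC.
- apply: (rhoV M0.+1); apply: bnd_le eB _ => a b.
  rewrite lcoefZ Normc.normcM (normc_nat 2) lcoef_restr /=.
  case: leqP => Bb; last first.
    by rewrite Normc.normc0 mulr0 !mulr_ge0 ?expR_ge0.
  rewrite -!mulrA ler_pM2l// (le_trans (xK a b))// ler_wpM2l// -expRD ler_expR.
  by have := expseq_le beta Bb; rewrite -natr1; lra.
Qed.

End Neighbourhoods.

(** Quantitative continuity: [m] depends on [n] alone, [N] and [C] also on [M]. For linear maps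
    [opb_clin] and [clin_opb] relate it to continuity. *)
Definition opb (T : L -> L) := forall n, exists m, forall M, exists N,
  exists2 C : R, 0 <= C &
    forall x K, bnd m M (lcoef x) K -> bnd n N (lcoef (T x)) (C * K).

Lemma opb_clin (T : L -> L) : condition_N beta -> linear T -> opb T -> clin T.
Proof.
move=> betaN lT oT; split=> //.
have lf : linear_for *:%R T by exact: lT.
pose lin := GRing.isLinear.Build R[i] L L *:%R T lf.
pose T' : {linear L -> L} := HB.pack T lin.
apply/(lc_initial_continuousP T') => n.
pose f : {linear L -> LB_space alpha beta n} := lambda_incl alpha beta n \o T'.
apply: (@linear_continuous0 _ _ _ f) => U /LB_nbhs0_ball[V [[cV bV] VU eV]].
have [m mP] := oT n.
have : nbhs (0 : L) [set x | V (f x)].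
  apply: (L_nbhs0 betaN (m := m)).
    have fP a x y : f (a *: x + y) = a *: f x + f y by exact: linearP.
    have fZ a x : f (a *: x) = a *: f x by exact: linearZ.
    split; last by move=> a x a1 Vx; apply: (eq_ind_r V _ (fZ a x)); exact: bV.
    apply/convex_setP => x y t t0 t1 Vx Vy.
    apply: (eq_ind_r V _ (fP _ _ _)); rewrite fZ.
    exact: (convex_setP V).1.
  move=> M; have [N [C C0 CP]] := mP M; have [e e0 eP] := eV N.
  have C1 : 0 < C + 1 by rewrite ltr_wpDl.
  exists (e / (C + 1)); first by rewrite divr_gt0.
  move=> x /CP xe; apply: eP; rewrite ucoef_incl; apply: bnd_le xe.
  by rewrite mulrCA ger_pMr// ler_pdivrMr// mul1r lerDl.
by apply: filterS => x; exact: VU.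
Qed.

(* That m can be chosen before M is the countable neighbourhood property of
   LB_space n: if every m fails for some M = Mf m, the countably many witnesses
   cut out one neighbourhood V of 0, and the preimage of V contradicts them. *)
Lemma clin_opb (T : L -> L) : clin T -> opb T.
Proof.
move=> Tl n; apply: contrapT => /forallNP noP.
have bad m : exists M, forall N, exists xKij : L * R * (nat * nat),
    bnd m M (lcoef xKij.1.1) xKij.1.2 /\
    N%:R * xKij.1.2 * expR (N%:R * beta xKij.2.2 - n%:R * alpha xKij.2.1)
      < normc (lcoef (T xKij.1.1) xKij.2).
  have /existsNP[M /forallNP MP] := noP m.
  exists M => N; apply: contrapT => /forallNP nN; apply: (MP N).
  exists N%:R => // x K xK i j; rewrite leNgt; apply/negP => h.
  by apply: (nN (x, K, (i, j))).
have {bad}[Mf MfP] := choice bad.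
have bad2 (mN : nat * nat) := MfP mN.1 mN.2.
have {bad2}[w wP] := choice bad2.
(* Only pairs with m <= N enter. In step N0 the conditions with N >= N0 hold for any radius up to 1,
   and only finitely many remain. *)
pose V : set (LB_space alpha beta n) := [set u |
  forall mN : {mN : nat * nat | (mN.1 <= mN.2)%N},
  normc (ucoef u (w (val mN)).2) <=
  expR ((val mN).2%:R * beta (w (val mN)).2.2 - n%:R * alpha (w (val mN)).2.1)].
have NV : nbhs 0 V.
  apply: LB_nbhs0.
    exact: (@coordinates_acx _ _ _ _ (@ucoef R alpha beta n)
      (fun mN : {mN : nat * nat | (mN.1 <= mN.2)%N} => (w (val mN)).2)
      _ (@ucoefP _ _ _ _)).
  move=> N0.
  pose J := (\max_(m < N0) \max_(N < N0) (w (m : nat, N : nat)).2.2)%N.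
  exists (expR (- (N0%:R * beta J))); first exact: expR_gt0.
  move=> u ue [[m N] /= mN]; case E : (w (m, N)).2 => [i j] /=.
  apply: (le_trans (ue i j)); rewrite -expRD ler_expR.
  have bge0 k : 0 <= beta k by exact/ltW/expseq_gt0.
  have [NN|NN] := leqP N0 N.
    have : N0%:R * beta j <= N%:R * beta j by rewrite ler_wpM2r// ler_nat.
    have : 0 <= N0%:R * beta J by rewrite mulr_ge0.
    lra.
  have jJ : (j <= J)%N.
    have mN0 := leq_ltn_trans mN NN.
    apply: leq_trans (leq_bigmax (Ordinal mN0)).
    apply: leq_trans (leq_bigmax (Ordinal NN)).
    by rewrite /= E.
  have : N0%:R * beta j <= N0%:R * beta J by rewrite ler_wpM2l// expseq_le.
  have : 0 <= N%:R * beta j by rewrite mulr_ge0.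
  lra.
have := Tl.2 0 _; rewrite /continuous_at (clin0 Tl) => /(_ _ (L_nbhs0_LB NV)).
move=> /L_nbhs0_ball[m /(_ (Mf m))[e e0 eV]].
(* N >= m makes the witness one of the conditions of [V]; N > 1/e makes it violate the bound. *)
pose N := maxn m (Num.truncn e^-1).+1.
have [] := wP (m, N); case wE: (w (m, N)) => [[x K] [i j]] /= xK.
set E := expR _; set Z := normc _ => big.
have E0 : 0 < E := expR_gt0 _.
have K0 := bnd_ge0 xK.
have eN : 1 <= e * N%:R.
  rewrite -ler_pdivrMl// mulr1; apply: (le_trans (ltW (truncnS_gt _))).
  by rewrite ler_nat leq_maxr.
have KZ : K * E < e * Z.
  apply: (@le_lt_trans _ _ (e * (N%:R * K * E))); last by rewrite ltr_pM2l.
  rewrite -[N%:R * _ * _]mulrA [leRHS]mulrA; apply: ler_peMl => //.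
  by rewrite mulr_ge0// ltW.
have Z0 : 0 < Z by rewrite -(pmulr_rgt0 _ e0) (le_lt_trans _ KZ)// mulr_ge0// ltW.
(* The gap allows K = 0: scaled by e / (K + eta), the vector x lies in the ball of radius e, while
   its image still exceeds the bound of [V]. *)
pose eta := (e * Z / E - K) / 2.
have KeZ : K < e * Z / E by rewrite ltr_pdivlMr.
have eta0 : 0 < eta by rewrite divr_gt0// subr_gt0.
have Keta : 0 < K + eta by rewrite ltr_wpDl.
pose a : R := e / (K + eta).
have a0 : 0 < a by rewrite divr_gt0.
have ya : bnd m (Mf m) (lcoef (a%:C%C *: x)) e.
  apply: bnd_le (bndZ a%:C%C xK); rewrite normc_real_ge0 ?(ltW a0)//.
  by rewrite mulrAC ler_pdivrMr// ler_pM2l// lerDl ltW.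
have : normc (lcoef (T (a%:C%C *: x)) (w (m, N)).2) <=
    expR (N%:R * beta (w (m, N)).2.2 - n%:R * alpha (w (m, N)).2.1).
  exact: eV _ ya (exist _ (m, N) (leq_maxl _ _)).
rewrite wE (clinZ Tl) lcoefZ [(_, _, _).2]/= -/E.
rewrite Normc.normcM normc_real_ge0 ?(ltW a0)// -/Z.
rewrite /a mulrAC ler_pdivrMr// [leRHS]mulrC -ler_pdivrMr// => h.
by move: h eta0; rewrite /eta; lra.
Qed.

(** One estimate both places [t x] in L and gives continuity, so operators can be defined by
    formulas on coefficients. *)
Lemma clin_of_coef (t : L -> nat * nat -> R[i]) : condition_N beta ->
  (forall a x y ij, t (a *: x + y) ij = a * t x ij + t y ij) ->
  (forall n, exists m, forall M, exists N, exists2 C : R,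
    0 <= C & forall x K, bnd m M (lcoef x) K -> bnd n N (t x) (C * K)) ->
  exists2 T : L -> L, clin T & forall x ij, lcoef (T x) ij = t x ij.
Proof.
move=> betaN lt ot.
have tL x : exists y : L, lcoef y = t x.
  apply: lcoef_surj => n; have [m mP] := ot n.
  have [M [K xK]] := lcoef_bnd x m; have [N [C _ CP]] := mP M.
  by exists N, (C * K); exact: CP.
have [T TE] := choice tL; exists T => [|x ij]; last by rewrite TE.
apply: opb_clin => //.
  by move=> a x y; apply: lcoef_inj => ij; rewrite lcoefP !TE lt.
move=> n; have [m mP] := ot n; exists m => M; have [N [C C0 CP]] := mP M.
by exists N, C => // x K /CP; rewrite TE.
Qed.

End ContinuousOperators.

(** * A bijection of N^3 onto N *)

Section DyadicIndex.

(** Each positive integer is 2^k (2r + 1) in exactly one way; the predecessor makes this a bijection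
    from N^2 onto N. *)
Definition kap k r := (2 ^ k * r.*2.+1).-1.

Lemma kapS k r : (kap k r).+1 = (2 ^ k * r.*2.+1)%N.
Proof. by rewrite prednK// muln_gt0 expn_gt0. Qed.

Definition kap1 n := logn 2 n.+1.
Definition kap2 n := (n.+1 %/ 2 ^ kap1 n)./2.

Lemma kap1K k r : kap1 (kap k r) = k.
Proof.
rewrite /kap1 kapS lognM ?expn_gt0// pfactorK// logn_coprime ?addn0//.
by rewrite coprime2n /= odd_double.
Qed.

Lemma kap2K k r : kap2 (kap k r) = r.
Proof.
by rewrite /kap2 kap1K kapS mulKn ?expn_gt0// -[r.*2.+1]/(true + r.*2)%N
  half_bit_double.
Qed.

Lemma kap12 n : kap (kap1 n) (kap2 n) = n.
Proof.
have [m cm] := pfactor_coprime (isT : prime 2) (ltn0Sn n).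
rewrite -/(kap1 n) => nE; have om : odd m by rewrite -coprime2n.
apply: succn_inj; rewrite kapS /kap2 [in LHS]nE mulnK ?expn_gt0//.
by have := odd_double_half m; rewrite om add1n mulnC => ->.
Qed.

Definition idx k p i := kap k (kap p i).
Definition idxk n := kap1 n.
Definition idxp n := kap1 (kap2 n).
Definition idxi n := kap2 (kap2 n).

Lemma idxK n : idx (idxk n) (idxp n) (idxi n) = n.
Proof. by rewrite /idx !kap12. Qed.

Lemma idxkK k p i : idxk (idx k p i) = k.
Proof. exact: kap1K. Qed.

Lemma idxpK k p i : idxp (idx k p i) = p.
Proof. by rewrite /idxp kap2K kap1K. Qed.

Lemma idxiK k p i : idxi (idx k p i) = i.
Proof. by rewrite /idxi !kap2K. Qed.

Lemma leq_kap k r : (r <= kap k r)%N.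
Proof.
rewrite -ltnS kapS (@leq_trans r.*2.+1)//; first by rewrite ltnS -addnn leq_addr.
by rewrite leq_pmull// expn_gt0.
Qed.

Lemma leq_idx k p i : (i <= idx k p i)%N.
Proof. exact: leq_trans (leq_kap _ _) (leq_kap _ _). Qed.

Lemma expn2_leq_idx k p i : (2 ^ p <= (idx k p i).+1)%N.
Proof.
apply: (@leq_trans (kap p i).+1); first by rewrite kapS leq_pmulr.
by rewrite ltnS leq_kap.
Qed.

Lemma kapSE p i : kap p.+1 i = (kap p i).*2.+1.
Proof. by apply: succn_inj; rewrite kapS expnS -mulnA -kapS; lia. Qed.

Lemma kap_mono k r s : (r <= s)%N -> (kap k r <= kap k s)%N.
Proof. by move=> rs; rewrite -ltnS !kapS leq_pmul2l ?expn_gt0//; lia. Qed.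

Lemma leq_idxS k p i : (idx k p i <= idx k p.+1 i)%N.
Proof. by apply: kap_mono; rewrite kapSE; lia. Qed.

(** Two steps i |-> 2i + 1 suffice whatever k is, since 2^k <= idx k p i + 1; this is the source of
    the uniformity in k. *)
Lemma idxS_leq k p i : (idx k p.+1 i <= ((idx k p i).*2.+1).*2.+1)%N.
Proof.
rewrite -ltnS /idx kapS kapSE.
have := kapS k (kap p i); set u := kap p i.
have : (2 ^ k <= (kap k u).+1)%N by rewrite kapS leq_pmulr.
move: (kap k u) => v; nia.
Qed.

(** The right side is reached from i by k + 2 steps i |-> 2i + 1. The dependence on k is harmless:
    for each n the lift needs it only for k <= n. *)
Lemma idx0_leq k i : (idx k 0 i <= (2 ^ k.+2 * i.+1).-1)%N.
Proof.
rewrite /idx; have -> : kap 0 i = i.*2 by rewrite /kap expn0 mul1n.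
have := kapS k i.*2; have : (0 < 2 ^ k)%N by rewrite expn_gt0.
rewrite !expnS; move: (kap _ _) (2 ^ k)%N => v e; nia.
Qed.

End DyadicIndex.

(** * Row weights of a stable sequence *)

Section StableSequences.
Context {R : realType} (a : exponent_sequence R).

Lemma stable_nat : stable a ->
  exists2 D : nat, (0 < D)%N & forall i, a i.*2.+1 <= D%:R * a i.
Proof.
rewrite /stable => sa.
have ub i := @ereal_sup_ubound R _ _ (imageT (fun i => (a (2 * i)%N / a i)%:E) i).
have a0 i : 0 < a i := expseq_gt0 a i.
have [M hM] : exists M : R, forall i, a (2 * i)%N <= M * a i.
  move: sa ub; case: ereal_sup => [M _ ub|//|_ ub].
    by exists M => i; rewrite -ler_pdivrMr// -lee_fin.
  by have := ub 0%N; rewrite leeNy_eq.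
have M1 : 1 <= M by have := hM 0%N; rewrite muln0 ler_pMl.
have M0 : 0 <= M := le_trans ler01 M1.
(* For i > 0, 2i + 1 <= 2(2i) costs M^2; the quotient a_1 / a_0 covers i = 0. *)
pose D := (Num.truncn (M * M + a 1%N / a 0%N)).+1.
have hD : M * M + a 1%N / a 0%N <= D%:R by exact/ltW/truncnS_gt.
exists D => // -[|i].
  apply: (@le_trans _ _ (a 1%N / a 0%N * a 0%N)); first by rewrite divfK// gt_eqF.
  rewrite ler_wpM2r ?(ltW (a0 _))//; apply: le_trans hD.
  by rewrite lerDr mulr_ge0.
apply: (@le_trans _ _ (M * M * a i.+1)).
  rewrite -mulrA; apply: (@le_trans _ _ (a (2 * (2 * i.+1))%N)).
    by apply: expseq_le; lia.
  by apply: (le_trans (hM _)); rewrite ler_wpM2l.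
rewrite ler_wpM2r ?(ltW (a0 _))//; apply: le_trans hD.
by rewrite lerDl divr_ge0// ltW.
Qed.

Variable D : nat.
Hypothesis D0 : (0 < D)%N.
Hypothesis aD : forall i, a i.*2.+1 <= D%:R * a i.

Definition om k p i : R := a (idx k p i).

Lemma om_gt0 k p i : 0 < om k p i.
Proof. exact: expseq_gt0. Qed.

Lemma om_le k p q i : (p <= q)%N -> om k p i <= om k q i.
Proof.
move=> /subnK <-; elim: (q - p)%N => [//|d IHd].
by apply: (le_trans IHd); apply: expseq_le; exact: leq_idxS.
Qed.

Lemma le_om k p i : a i <= om k p i.
Proof. by apply: expseq_le; exact: leq_idx. Qed.

Lemma omS_le k p i : om k p.+1 i <= (D ^ 2)%:R * om k p i.
Proof.
apply: (le_trans (expseq_le _ (idxS_leq _ _ _))).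
rewrite expnS expn1 natrM -mulrA; apply: (le_trans (aD _)).
by rewrite ler_wpM2l.
Qed.

Lemma om0_le k i : om k 0 i <= (D ^ k.+2)%:R * a i.
Proof.
apply: (le_trans (expseq_le _ (idx0_leq _ _))).
elim: k.+2 => [|{}k IHk]; first by rewrite !expn0 !mul1n mul1r.
rewrite [(D ^ _.+1)%N]expnS natrM -mulrA.
apply: (@le_trans _ _ (D%:R * a (2 ^ k * i.+1).-1)); last by rewrite ler_wpM2l.
rewrite (_ : (2 ^ k.+1 * i.+1).-1 = (2 ^ k * i.+1).-1.*2.+1) ?aD// expnS -mulnA.
have : (0 < 2 ^ k * i.+1)%N by rewrite muln_gt0 expn_gt0.
by move: (2 ^ k * i.+1)%N => n; lia.
Qed.

Variable c : nat.
Hypothesis ac : forall i, 1 + i%:R <= expR (c%:R * a i) :> R.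

(** Condition (N) at an index of size at least 2^p - 1: c levels buy geometric decay in p, uniformly
    in k and i. *)
Lemma exp_om_le k p i : expR (- (c%:R * om k p i)) <= (2 ^ p)%:R^-1.
Proof.
rewrite expRN lef_pV2 ?posrE ?expR_gt0 ?ltr0n ?expn_gt0//.
by apply: le_trans (ac _); rewrite nat1r ler_nat expn2_leq_idx.
Qed.

End StableSequences.

(** * Geometrically convergent series *)

Section GeometricSums.
Context {R : realType}.
Local Notation normc := Normc.normc.
Implicit Types (u v : nat -> R[i]).

(* Summability at rate 2^-p suffices here and spares a discussion of limits
   of complex sequences. *)
Definition csums u (l : R[i]) := exists K : R, forall p,
  normc (\sum_(r < p) u r - l) <= K / (2 ^ p)%:R.

Lemma geometric_small (K e : R) : 0 < e -> exists p, K / (2 ^ p)%:R <= e.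
Proof.
move=> e0; exists (Num.truncn (K / e)).+1; rewrite ler_pdivrMr ?ltr0n ?expn_gt0//.
rewrite mulrC -ler_pdivrMr//; apply: (le_trans (ltW (truncnS_gt _))).
by rewrite ler_nat ltnW// ltn_expl.
Qed.

Lemma geometric_small_after (K e : R) p : 0 <= K -> 0 < e ->
  exists2 q, (p <= q)%N & K / (2 ^ q)%:R <= e.
Proof.
move=> K0 e0; have [q hq] := geometric_small K e0; exists (maxn p q).
  exact: leq_maxl.
apply: le_trans hq; rewrite ler_wpM2l// lef_pV2 ?posrE ?ltr0n ?expn_gt0//.
by rewrite ler_nat leq_exp2l// leq_maxr.
Qed.

(** [N] is any subadditive function, so as to cover the complex modulus, the real absolute value and
    the identity. *)
Lemma geometric_tail (V : nmodType) (N : V -> R) (u : nat -> V) (K : R) p d :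
  N 0 = 0 -> (forall x y, N (x + y) <= N x + N y) ->
  (forall r, (p <= r)%N -> N (u r) <= K / (2 ^ r)%:R) ->
  N (\sum_(p <= r < p + d) u r) <= 2 * K / (2 ^ p)%:R - 2 * K / (2 ^ (p + d))%:R.
Proof.
move=> N0 ND uK; elim: d => [|d IHd].
  by rewrite addn0 big_geq// N0 subrr.
rewrite addnS big_nat_recr ?leq_addr//=; apply: (le_trans (ND _ _)).
apply: (le_trans (lerD IHd (uK _ (leq_addr _ _)))).
rewrite expnS natrM invfM.
by set A := (2 ^ (p + d))%:R^-1; lra.
Qed.

(** The constant hidden in [csums] is traded for that of the terms, by comparing with a partial sum
    far out. *)
Lemma csums_tail u l K p : csums u l ->
  (forall r, (p <= r)%N -> normc (u r) <= K / (2 ^ r)%:R) ->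
  normc (\sum_(r < p) u r - l) <= 2 * K / (2 ^ p)%:R.
Proof.
move=> [K' ul] uK.
have K0 : 0 <= K.
  have := le_trans (normc_ge0 _) (uK p (leqnn p)).
  by rewrite pmulr_lge0// invr_gt0 ltr0n expn_gt0.
have K'0 : 0 <= K'.
  have := le_trans (normc_ge0 _) (ul 0%N).
  by rewrite pmulr_lge0// invr_gt0 ltr0n expn_gt0.
apply/ler_addgt0Pr => e e0.
have [q pq qe] := geometric_small_after p K'0 e0.
have -> : \sum_(r < p) u r - l =
    (\sum_(r < q) u r - l) - \sum_(p <= r < p + (q - p)) u r.
  rewrite subnKC// -!(big_mkord xpredT) (big_cat_nat (leq0n p) pq)/=.
  by rewrite addrAC addrK.
rewrite (le_trans (le_normcD _ _))// normcN addrC lerD//; last first.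
  exact: le_trans (ul q) qe.
apply: (le_trans (geometric_tail (q - p) (@Normc.normc0 _) (@le_normcD _) uK)).
by rewrite gerBl mulr_ge0 ?mulr_ge0.
Qed.

Lemma csums_unique u l l' : csums u l -> csums u l' -> l = l'.
Proof.
move=> [K ul] [K' ul']; apply/eqP; rewrite -subr_eq0; apply/eqP/Normc.eq0_normc.
apply/eqP; rewrite eq_le normc_ge0 andbT; apply/ler_addgt0Pr => e e0.
rewrite add0r; have [p pe] := geometric_small (K + K') e0.
apply: le_trans pe; rewrite mulrDl [leRHS]addrC.
have -> : l - l' = (\sum_(r < p) u r - l') - (\sum_(r < p) u r - l).
  by rewrite opprB [RHS]addrC addrA subrK.
by rewrite (le_trans (le_normcD _ _))// normcN lerD.
Qed.

Lemma csumsP a u v l l' : csums u l -> csums v l' ->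
  csums (fun r => a * u r + v r) (a * l + l').
Proof.
move=> [K ul] [K' vl]; exists (normc a * K + K') => p.
rewrite big_split /= -mulr_sumr opprD addrACA -mulrBr.
rewrite (le_trans (le_normcD _ _))// Normc.normcM mulrDl.
by apply: lerD (vl p); rewrite -mulrA ler_wpM2l ?normc_ge0 ?ul.
Qed.

Lemma real_geometric_series (u : nat -> R) K :
  (forall r, `|u r| <= K / (2 ^ r)%:R) ->
  exists l, forall p, `|\sum_(r < p) u r - l| <= 2 * K / (2 ^ p)%:R.
Proof.
move=> uK.
have K0 : 0 <= K by have := le_trans (normr_ge0 _) (uK 0%N); rewrite invr1 mulr1.
have cu : cvgn (series u).
  apply: normed_cvg; apply: (@series_le_cvg _ _ (geometric K 2^-1)).
  - by move=> r; exact: normr_ge0.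
  - by move=> r; rewrite /geometric/= mulr_ge0// exprn_ge0.
  - by move=> r; apply: (le_trans (uK r)); rewrite /geometric/= exprVn natrX.
  - apply: is_cvg_geometric_series.
    by rewrite ger0_norm// invf_lt1// ltr1n.
exists (limn (series u)) => p; apply/ler_addgt0Pr => e e0.
have /cvgrPdist_le/(_ e e0)[q0 _ hq] := cu.
have qe := hq (maxn p q0) (leq_maxr _ _).
have pq := leq_maxl p q0; move: (maxn p q0) pq qe => q pq qe.
have -> : \sum_(r < p) u r - limn (series u) =
    - (limn (series u) - series u q) - \sum_(p <= r < p + (q - p)) u r.
  rewrite subnKC// /series /= -(big_mkord xpredT) (big_cat_nat (leq0n p) pq)/=.
  by rewrite opprB addrAC addrK.
rewrite (le_trans (ler_normD _ _))// !normrN addrC lerD//.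
apply: (le_trans (geometric_tail (q - p) (@normr0 _ _) (@ler_normD _ _)
  (fun r _ => uK r))).
by rewrite gerBl mulr_ge0 ?mulr_ge0.
Qed.

Lemma csums_exists u K : (forall r, normc (u r) <= K / (2 ^ r)%:R) ->
  exists l, csums u l.
Proof.
move=> uK.
have ReE p : complex.Re (\sum_(r < p) u r) = \sum_(r < p) complex.Re (u r).
  elim: p => [|p IHp]; first by rewrite !big_ord0.
  by rewrite !big_ord_recr -IHp /=; case: (\sum_(r < p) u r) (u p) => ? ? [].
have ImE p : complex.Im (\sum_(r < p) u r) = \sum_(r < p) complex.Im (u r).
  elim: p => [|p IHp]; first by rewrite !big_ord0.
  by rewrite !big_ord_recr -IHp /=; case: (\sum_(r < p) u r) (u p) => ? ? [].
have [|l1 h1] := @real_geometric_series (fun r => complex.Re (u r)) K.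
  move=> r; apply: le_trans (uK r).
  by case: (u r) => x y /=; rewrite -sqrtr_sqr ler_wsqrtr// lerDl sqr_ge0.
have [|l2 h2] := @real_geometric_series (fun r => complex.Im (u r)) K.
  move=> r; apply: le_trans (uK r).
  by case: (u r) => x y /=; rewrite -sqrtr_sqr ler_wsqrtr// lerDr sqr_ge0.
exists (l1 +i* l2)%C, (2 * K + 2 * K) => p.
have nle (z : R[i]) : normc z <= `|complex.Re z| + `|complex.Im z|.
  case: z => x y /=; rewrite -[leRHS]ger0_norm ?addr_ge0// -sqrtr_sqr.
  rewrite ler_wsqrtr// sqrrD !real_normK ?num_real// lerD2r lerDl.
  by rewrite mulrn_wge0// mulr_ge0.
apply: (le_trans (nle _)); rewrite mulrDl lerD//.
  apply: le_trans (h1 p); rewrite -ReE.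
  by case: (\sum_(r < p) u r).
apply: le_trans (h2 p); rewrite -ImE.
by case: (\sum_(r < p) u r).
Qed.

(** Total, with default 0, so that series define coefficients; linearity then follows from
    uniqueness of the sum. *)
Definition csum u : R[i] := xget 0 [set l | csums u l].

Lemma csum_csums u : (exists l, csums u l) -> csums u (csum u).
Proof. by move=> [l ul]; rewrite /csum; case: xgetP => [l' _|/(_ l ul)]. Qed.

Lemma csum_eq u l : csums u l -> csum u = l.
Proof.
by move=> ul; exact: csums_unique (csum_csums (ex_intro _ l ul)) ul.
Qed.

End GeometricSums.

(** * The exact sequence and the lifting *)

Section Operators.
Context {R : realType} {alpha beta : exponent_sequence R}.
Local Notation L := (Lambda_infty alpha beta).
Local Notation normc := Normc.normc.
Local Notation bnd := (@bnd R alpha beta).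
Local Notation om := (om alpha).
Implicit Types (x y : L) (n N m M k p i j : nat).

Variables D c : nat.
Hypothesis betaN : condition_N beta.
Hypothesis D0 : (0 < D)%N.
Hypothesis aD : forall i, alpha i.*2.+1 <= D%:R * alpha i.
Hypothesis ac : forall i, 1 + i%:R <= expR (c%:R * alpha i) :> R.

Definition cexp (r : R) : R[i] := (expR r)%:C%C.

Lemma cexpD r s : cexp (r + s) = cexp r * cexp s.
Proof. by rewrite /cexp expRD rmorphM. Qed.

Lemma cexp0 : cexp 0 = 1.
Proof. by rewrite /cexp expR0. Qed.

Lemma normc_cexp r : normc (cexp r) = expR r.
Proof. by rewrite normc_real_ge0// expR_ge0. Qed.

Lemma bnd_idx n N (t : nat * nat -> R[i]) (K : R) :
  (forall k p i j, normc (t (idx k p i, j)) <=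
     K * expR (N%:R * beta j - n%:R * om k p i)) -> bnd n N t K.
Proof.
by move=> h n' j; have := h (idxk n') (idxp n') (idxi n') j; rewrite /om idxK.
Qed.

Lemma alpha_ge0 i : 0 <= alpha i. Proof. exact/ltW/expseq_gt0. Qed.
Lemma beta_ge0 i : 0 <= beta i. Proof. exact/ltW/expseq_gt0. Qed.

(** Inserting a vector into the even or odd rows multiplies the row weights by at most D, by
    stability; reading these rows off only lowers the weights. *)
Lemma even_odd_rows : exists s0 s1 t0 t1 : L -> L,
  [/\ clin s0, clin s1, clin t0 & clin t1] /\
  [/\ forall x, t0 (s0 x) = x, forall x, t0 (s1 x) = 0,
      forall x, t1 (s0 x) = 0, forall x, t1 (s1 x) = x &
      forall x, s0 (t0 x) + s1 (t1 x) = x].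
Proof.
have half_le i : alpha i <= D%:R * alpha i./2.
  apply: le_trans (aD _); apply: expseq_le.
  by rewrite -{1}(odd_double_half i); case: odd => /=; lia.
have ins (b : bool) : exists2 s : L -> L, clin s & forall y i j,
    lcoef (s y) (i, j) = if odd i == b then lcoef y (i./2, j) else 0.
  have [||s sl sE] := @clin_of_coef R alpha beta (fun y ij =>
      if odd ij.1 == b then lcoef y (ij.1./2, ij.2) else 0) betaN; first 1 last.
  - move=> n; exists (n * D)%N => M; exists M, 1 => // x K xK i j /=.
    rewrite mul1r; case: ifP => _; last first.
      by rewrite Normc.normc0 mulr_ge0 ?expR_ge0 ?(bnd_ge0 xK).
    apply: (le_trans (xK _ _)); rewrite ler_wpM2l ?(bnd_ge0 xK)// ler_expR.
    by rewrite lerB// natrM -mulrA ler_wpM2l.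
  - by exists s => // y i j; rewrite sE.
  - by move=> a x y ij; rewrite lcoefP; case: ifP; rewrite ?mulr0 ?addr0.
have del (b : bool) : exists2 t : L -> L, clin t & forall x i j,
    lcoef (t x) (i, j) = lcoef x ((b + i.*2)%N, j).
  have [||t tl tE] := @clin_of_coef R alpha beta
      (fun x ij => lcoef x ((b + ij.1.*2)%N, ij.2)) betaN; first 1 last.
  - move=> n; exists n => M; exists M, 1 => // x K xK i j /=.
    rewrite mul1r; apply: (le_trans (xK _ _)).
    rewrite ler_wpM2l ?(bnd_ge0 xK)// ler_expR lerB// ler_wpM2l//.
    by apply: expseq_le; lia.
  - by exists t => // x i j; rewrite tE.
  - by move=> a x y ij; rewrite lcoefP.
have oddD (b : bool) i : odd (b + i.*2) = b by rewrite oddD odd_double addbF oddb.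
have halfD (b : bool) i : (b + i.*2)./2 = i := half_bit_double i b.
have [[s0 s0l s0E] [s1 s1l s1E]] := (ins false, ins true).
have [[t0 t0l t0E] [t1 t1l t1E]] := (del false, del true).
exists s0, s1, t0, t1; split=> //; split=> x; apply: lcoef_inj => -[i j].
- by rewrite t0E s0E oddD halfD.
- by rewrite t0E s1E oddD lcoef0.
- by rewrite t1E s0E oddD lcoef0.
- by rewrite t1E s1E oddD halfD.
- rewrite lcoefD s0E s1E t0E t1E -{5}(odd_double_half i).
  by case: odd; rewrite ?addr0 ?add0r.
Qed.

Definition qterm k x i j r : R[i] :=
  cexp (k%:R * om k r i) * lcoef x (idx k r i, j).

Lemma qtermP k a x y i j r :
  qterm k (a *: x + y) i j r = a * qterm k x i j r + qterm k y i j r.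
Proof. by rewrite /qterm lcoefP mulrDr mulrCA. Qed.

(** Of the n + k + c levels, k absorb the factor exp(k om) and c give the decay 2^-r. *)
Lemma qterm_le k n N x (K : R) i j r : bnd (n + k + c) N (lcoef x) K ->
  normc (qterm k x i j r) <=
    K * expR (N%:R * beta j - n%:R * om k r i) / (2 ^ r)%:R.
Proof.
move=> xK; have K0 := bnd_ge0 xK; rewrite /qterm Normc.normcM normc_cexp.
apply: (@le_trans _ _ (expR (k%:R * om k r i) *
    (K * expR (N%:R * beta j - (n + k + c)%:R * om k r i)))).
  by rewrite ler_wpM2l ?expR_ge0//; exact: xK.
apply: (@le_trans _ _ (K * expR (N%:R * beta j - n%:R * om k r i) *
    expR (- (c%:R * om k r i)))).
  rewrite mulrCA -mulrA -!expRD ler_wpM2l// ler_expR !natrD.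
  by rewrite le_eqVlt; apply/orP; left; apply/eqP; ring.
by rewrite ler_wpM2l ?mulr_ge0 ?expR_ge0 ?exp_om_le.
Qed.

Lemma evaluations : exists q : nat -> L -> L, (forall k, clin (q k)) /\
  forall k x i j, csums (qterm k x i j) (lcoef (q k x) (i, j)).
Proof.
have ex k x i j : exists l, csums (qterm k x i j) l.
  have [N [K xK]] := lcoef_bnd x (0 + k + c).
  apply: (@csums_exists _ _ (K * expR (N%:R * beta j))) => r.
  by apply: le_trans (qterm_le i j r xK) _; rewrite mul0r subr0.
pose t k x (ij : nat * nat) := csum (qterm k x ij.1 ij.2).
have tP k x ij : csums (qterm k x ij.1 ij.2) (t k x ij) by exact: csum_csums.
have hq k : exists q : L -> L, clin q /\
    forall x i j, csums (qterm k x i j) (lcoef (q x) (i, j)).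
  have [||q ql qE] := @clin_of_coef R alpha beta (t k) betaN; first 1 last.
  (* The level may depend on k, each q_k being a separate operator; 2 is the sum of the 2^-r. *)
  - move=> n; exists (n + k + c)%N => M; exists M, 2 => // x K xK i j.
    have := @csums_tail _ _ _ (K * expR (M%:R * beta j - n%:R * alpha i)) 0
      (tP k x (i, j)).
    rewrite big_ord0 sub0r normcN expn0 invr1 mulr1 => h.
    rewrite -mulrA; apply: h.
    move=> r _; apply: (le_trans (qterm_le i j r xK)).
    rewrite ler_wpM2r// ler_wpM2l ?(bnd_ge0 xK)// ler_expR lerB// ler_wpM2l//.
    exact: le_om.
  - by exists q; split=> // x i j; rewrite qE; exact: (tP k x (i, j)).
  - move=> a x y ij; apply: csum_eq.
    rewrite (_ : qterm _ _ _ _ =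
        fun r => a * qterm k x ij.1 ij.2 r + qterm k y ij.1 ij.2 r).
      exact: csumsP.
    by apply/funext => r; exact: qtermP.
have [q qP] := choice hq.
by exists q; split=> k; have [] := qP k.
Qed.

(* In the coordinates u_p = exp(k om_p) x_p this is v |-> (v_p - v_(p-1))_p,
   whose image is the set of u with sum zero. *)
Lemma differences : exists2 S : L -> L, clin S & forall y k p i j,
  \sum_(r < p.+1) qterm k (S y) i j r = qterm k y i j p.
Proof.
(* Here [alpha nj.1] is om k p i, so this is v_p - v_(p-1) divided by exp(k om_p), with v_(-1) =
   0. *)
pose t y (nj : nat * nat) : R[i] := lcoef y nj -
  (if idxp nj.1 is p'.+1 then
     cexp ((idxk nj.1)%:R * (om (idxk nj.1) p' (idxi nj.1) - alpha nj.1)) *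
     lcoef y (idx (idxk nj.1) p' (idxi nj.1), nj.2) else 0).
have [||S Sl SE] := @clin_of_coef R alpha beta t betaN; first 1 last.
(* Row p - 1 at level n D^2 controls row p at level n, uniformly in k; the exponential factor is at
   most 1. *)
- move=> n; exists (n * D ^ 2)%N => M; exists M, 2 => // y K yK.
  have K0 := bnd_ge0 yK; apply: bnd_idx => k p i j; rewrite /t /= idxkK idxpK idxiK.
  rewrite (le_trans (le_normcD _ _))// normcN -mulrA [leRHS]mulr_natl mulr2n lerD//.
    apply: (le_trans (yK _ _)); rewrite ler_wpM2l// ler_expR lerB//.
    by rewrite ler_wpM2r ?alpha_ge0// ler_nat leq_pmulr// expn_gt0 D0.
  case: p => [|p]; first by rewrite Normc.normc0 mulr_ge0 ?expR_ge0.
  rewrite Normc.normcM normc_cexp.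
  apply: (@le_trans _ _
    (1 * (K * expR (M%:R * beta j - (n * D ^ 2)%:R * om k p i)))).
    apply: ler_pM; rewrite ?expR_ge0 ?normc_ge0//.
    rewrite -[leRHS]expR0 ler_expR mulr_ge0_le0// subr_le0.
    exact: om_le.
  rewrite mul1r ler_wpM2l// ler_expR lerB// natrM -mulrA ler_wpM2l//.
  exact: omS_le.
- exists S => // y k p i j.
  elim: p => [|p IHp].
    by rewrite big_ord_recl big_ord0 addr0 /qterm SE /t /= idxpK subr0.
  rewrite big_ord_recr /= IHp /qterm SE /t /= idxkK idxpK idxiK -/(om k p.+1 i).
  rewrite mulrBr mulrA -cexpD -mulrDr [X in om k p i - X]/(om k p.+1 i).
  by rewrite [om k p.+1 i + _]addrC subrK addrC subrK.
- move=> a x y [n j]; move: (a *: x + y) (lcoefP a x y) => v vE.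
  rewrite /t /=; case: (idxp n) => [|p]; rewrite !vE.
    by rewrite !subr0.
  by ring.
Qed.

(** The inverse of a difference operator is formed by partial sums. The point is to bound them
    uniformly in k, where the vanishing of q_k W enters. *)
Lemma differences_ker_factor (q : nat -> L -> L) (S : L -> L) :
  (forall k x i j, csums (qterm k x i j) (lcoef (q k x) (i, j))) ->
  (forall y k p i j, \sum_(r < p.+1) qterm k (S y) i j r = qterm k y i j p) ->
  forall W : L -> L, clin W -> (forall k x, q k (W x) = 0) ->
  exists2 W', clin W' & forall x, S (W' x) = W x.
Proof.
move=> qE SE W Wl qW.
pose v x k p i j := cexp (- (k%:R * om k p i)) *
  \sum_(r < p.+1) qterm k (W x) i j r.
pose t x (nj : nat * nat) : R[i] := v x (idxk nj.1) (idxp nj.1) (idxi nj.1) nj.2.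
have [||W' W'l W'E] := @clin_of_coef R alpha beta t betaN; first 1 last.
- move=> n; have [m mP] := clin_opb Wl (n + c); exists m => M.
  have [N [C C0 CP]] := mP M; exists N, (2 * C); first by rewrite mulr_ge0.
  move=> x K /CP; rewrite -mulrA; move: (C * K) => {}K WK; have K0 := bnd_ge0 WK.
  apply: bnd_idx => k p i j; rewrite /t /= idxkK idxpK idxiK /v.
  rewrite Normc.normcM normc_cexp expRN mulrC ler_pdivrMr ?expR_gt0//.
  (* For k < n, q_k (W x) = 0 turns the partial sum up to p into minus the tail after p, where -(n -
     k) om_r <= -(n - k) om_p. For k >= n the sum over r <= p is bounded directly, as (k - n) om_r
     <= (k - n) om_p. *)
  have [kn|nk] := ltnP k n.
    have WK' : bnd (n - k + k + c) N (lcoef (W x)) K by rewrite subnK// ltnW.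
    have q0 : csums (qterm k (W x) i j) 0.
      by rewrite -(@lcoef0 R alpha beta (i, j)) -(qW k x).
    have := csums_tail (p := p.+1)
      (K := K * expR (N%:R * beta j - (n - k)%:R * om k p i)) q0.
    rewrite subr0 => h; apply: (le_trans (h _)).
      move=> r pr; apply: (le_trans (qterm_le i j r WK')).
      rewrite ler_wpM2r// ler_wpM2l// ler_expR lerB// ler_wpM2l// om_le//.
      exact: ltnW.
    rewrite -!mulrA ler_wpM2l//; rewrite ler_wpM2l// -expRD.
    rewrite natrB ?(ltnW kn)//.
    apply: (@le_trans _ _ (expR (N%:R * beta j - (n%:R - k%:R) * om k p i))).
      by rewrite ler_piMr ?expR_ge0// invf_le1 ?ltr0n ?expn_gt0// ler1n expn_gt0.
    by rewrite ler_expR; lra.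
  rewrite -(big_mkord xpredT).
  (* Terms beyond p are cut off, since the bound uses om_r <= om_p. *)
  have h : forall r, (0 <= r)%N ->
      (if (r <= p)%N then normc (qterm k (W x) i j r) else 0) <=
      K * expR (N%:R * beta j - n%:R * om k p i + k%:R * om k p i) / (2 ^ r)%:R.
    move=> r _; case: ifP => rp; last by rewrite !mulr_ge0 ?expR_ge0.
    rewrite /qterm Normc.normcM normc_cexp.
    apply: (@le_trans _ _ (expR (k%:R * om k r i) *
        (K * expR (N%:R * beta j - (n + c)%:R * om k r i)))).
      by rewrite ler_wpM2l ?expR_ge0//; exact: WK.
    apply: (@le_trans _ _ (K *
        expR (N%:R * beta j - n%:R * om k p i + k%:R * om k p i) *
        expR (- (c%:R * om k r i)))); last first.
      by rewrite ler_wpM2l ?mulr_ge0 ?expR_ge0 ?exp_om_le.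
    rewrite mulrCA -mulrA -!expRD ler_wpM2l// ler_expR natrD.
    have : (k%:R - n%:R) * om k r i <= (k%:R - n%:R) * om k p i.
      by rewrite ler_wpM2l ?subr_ge0 ?ler_nat ?om_le.
    lra.
  have := @geometric_tail R R id _ _ 0 p.+1 erefl (fun _ _ => lexx _) h.
  rewrite add0n expn0 invr1 mulr1 expRD mulrA => g.
  apply: (@le_trans _ _ (\sum_(0 <= r < p.+1)
      (if (r <= p)%N then normc (qterm k (W x) i j r) else 0))).
    rewrite !big_mkord; elim/big_ind2 : _ => [|a b a' b' ab ab'|r _].
    - by rewrite Normc.normc0.
    - by apply: (le_trans (le_normcD _ _)); exact: lerD.
    - by rewrite -ltnS ltn_ord.
  apply: (le_trans g); rewrite -!mulrA gerBl !mulr_ge0 ?expR_ge0//.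
- exists W' => // x; apply: lcoef_inj => -[n j].
  rewrite -[n]idxK; move: (idxk n) (idxp n) (idxi n) => k p i.
  have e0 r : cexp r != 0.
    apply: contraTneq (expR_gt0 r) => e0.
    by rewrite -normc_cexp e0 Normc.normc0 ltxx.
  apply: (mulfI (e0 (k%:R * om k p i))).
  have sumE p' : qterm k (W' x) i j p' = \sum_(r < p'.+1) qterm k (W x) i j r.
    rewrite /qterm W'E /t /= idxkK idxpK idxiK /v mulrA -cexpD subrr cexp0.
    by rewrite mul1r.
  rewrite -/(qterm k (S (W' x)) i j p) -/(qterm k (W x) i j p).
  case: p => [|p].
    by have := SE (W' x) k 0%N i j; rewrite sumE !big_ord_recl !big_ord0 !addr0.
  have := SE (W' x) k p.+1 i j; rewrite sumE big_ord_recr SE sumE.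
  by rewrite [RHS]big_ord_recr => /addrI.
- move=> a x y [n j]; rewrite /t /v /=.
  under eq_bigr do rewrite Wl.1 qtermP.
  by rewrite big_split /= -mulr_sumr; ring.
Qed.

Lemma opb_choice (T : nat -> L -> L) (n : nat -> nat) : (forall k, opb (T k)) ->
  exists (m : nat -> nat) (N : nat -> nat -> nat) (C : nat -> nat -> R),
  forall k M, 0 <= C k M /\ forall x K, bnd (m k) M (lcoef x) K ->
    bnd (n k) (N k M) (lcoef (T k x)) (C k M * K).
Proof.
move=> oT; have [m mP] := choice (fun k => oT k (n k)).
have h (kM : nat * nat) : exists NC : nat * R,
    0 <= NC.2 /\ forall x K, bnd (m kM.1) kM.2 (lcoef x) K ->
      bnd (n kM.1) NC.1 (lcoef (T kM.1 x)) (NC.2 * K).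
  by have [N [C C0 CP]] := mP kM.1 kM.2; exists (N, C).
have [NC NCP] := choice h.
exists m, (fun k M => (NC (k, M)).1), (fun k M => (NC (k, M)).2) => k M.
exact: NCP (k, M).
Qed.

Lemma sum_ge_term (F : nat -> nat) n k : (k < n)%N -> (F k <= \sum_(l < n) F l)%N.
Proof. by move=> kn; rewrite (bigD1 (Ordinal kn))//= leq_addr. Qed.

Lemma sumr_ge_term (F : nat -> R) n k : (forall l, 0 <= F l) -> (k < n)%N ->
  F k <= \sum_(l < n) F l.
Proof.
by move=> F0 kn; rewrite (bigD1 (Ordinal kn))//= lerDl sumr_ge0.
Qed.

(* The k-th component of the lift is spread over the blocks (k, p), cutting the
   argument of T_k at rows a with s_k (1 + alpha_a + beta_j) <= om k p i: the
   factor exp (- k om k p i) then absorbs, for k > n, all the constants of T_k,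
   uniformly in k, because s_k dominates the first k of them. *)
Lemma lifting (q : nat -> L -> L) (T : nat -> L -> L) :
  (forall k x i j, csums (qterm k x i j) (lcoef (q k x) (i, j))) ->
  (forall k, clin (T k)) ->
  exists2 T', clin T' & forall k x, q k (T' x) = T k x.
Proof.
move=> qE Tl; have oT k := clin_opb (Tl k).
have [m0 [N0 [C0 T0]]] := opb_choice (fun=> 0%N) oT.
have C00 k M : 0 <= C0 k M by case: (T0 k M).
have {}T0 k M x K : bnd (m0 k) M (lcoef x) K ->
    bnd 0 (N0 k M) (lcoef (T k x)) (C0 k M * K) by case: (T0 k M) => _; exact.
pose s k := (1 + m0 k + \sum_(M < k.+1) (N0 k M + (Num.truncn (C0 k M)).+1))%N.
have s0 k : (0 < s k)%N by rewrite /s.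
have sm k : (m0 k <= s k)%N by rewrite /s; lia.
have sNC k M : (M <= k)%N -> (N0 k M + (Num.truncn (C0 k M)).+1 <= s k)%N.
  rewrite -ltnS => Mk; apply: leq_trans (leq_addl _ _).
  exact: sum_ge_term (fun M => N0 k M + (Num.truncn (C0 k M)).+1)%N _ _ Mk.
have sN k M : (M <= k)%N -> (N0 k M <= s k)%N by move=> /sNC; lia.
have sC k M : (M <= k)%N -> C0 k M <= expR (s k)%:R.
  move=> /sNC Mk; apply: (le_trans (ltW (truncnS_gt _))).
  apply: (@le_trans _ _ (s k)%:R); first by rewrite ler_nat
    (leq_trans _ Mk)// leq_addl.
  by apply: le_trans (expR_ge1Dx _); rewrite lerDr.
have om0 k p i : 0 <= om k p i by exact/ltW/om_gt0.
pose A k p i j (ab : nat * nat) := (s k)%:R * (1 + alpha ab.1 + beta j) <= om k p i.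
pose B k p i j ab := A k p i j ab &&
  (if p is p'.+1 then ~~ A k p' i j ab else true).
pose v k p i j x := lcoef (T k (restr (B k p i j) x)) (i, j).
pose t x (nj : nat * nat) : R[i] :=
  cexp (- ((idxk nj.1)%:R * om (idxk nj.1) (idxp nj.1) (idxi nj.1))) *
  v (idxk nj.1) (idxp nj.1) (idxi nj.1) nj.2 x.
have [||T' T'l T'E] := @clin_of_coef R alpha beta t betaN; first 1 last.
- move=> n.
  (* For the block p = 0 with k <= n, where om k 0 i <= D^(k+2) alpha_i. *)
  have [m1 [N1 [C1 T1]]] := opb_choice (fun k => n * D ^ k.+2)%N oT.
  have C10 k M : 0 <= C1 k M by case: (T1 k M).
  (* For later blocks with k <= n: outside [A k p], n om_(p+1) <= E_k (1 + alpha_a + beta_j), so E_k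
     more levels of the argument yield exp(-n om_(p+1)). *)
  pose E k := (n * D ^ 2 * s k)%N.
  exists (\sum_(k < n.+1) (m1 k + (E k + m0 k)))%N; set m := (\sum_(k < _) _)%N.
  have mP k : (k <= n)%N -> (m1 k <= m /\ E k + m0 k <= m)%N.
    rewrite -ltnS => kn; have : (m1 k + (E k + m0 k) <= m)%N.
      exact: sum_ge_term (fun k => m1 k + (E k + m0 k))%N _ _ kn.
    lia.
  move=> M.
  exists (\sum_(k < n.+1) (N1 k M + (N0 k M + E k)) + \sum_(k < M) N0 k M)%N.
  set N := (_ + _)%N.
  have NP k : (k <= n)%N -> (N1 k M <= N /\ N0 k M + E k <= N)%N.
    rewrite -ltnS => kn; have : (N1 k M + (N0 k M + E k) <= N)%N.
      apply: leq_trans (leq_addr _ _).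
      exact: sum_ge_term (fun k => N1 k M + (N0 k M + E k))%N _ _ kn.
    lia.
  have NM k : (k < M)%N -> (N0 k M <= N)%N.
    move=> kM; apply: leq_trans (leq_addl _ _).
    exact: sum_ge_term (fun k => N0 k M) _ _ kM.
  pose C := 1 + \sum_(k < n.+1) (C1 k M + C0 k M * expR (E k)%:R) +
    \sum_(k < M) C0 k M.
  have pos1 k : 0 <= C1 k M + C0 k M * expR (E k)%:R.
    by rewrite addr_ge0 ?mulr_ge0 ?expR_ge0.
  have sum1 : 0 <= \sum_(k < n.+1) (C1 k M + C0 k M * expR (E k)%:R).
    by rewrite sumr_ge0.
  have sum2 : 0 <= \sum_(k < M) C0 k M by rewrite sumr_ge0.
  have Cge k : (k <= n)%N -> C1 k M <= C /\ C0 k M * expR (E k)%:R <= C.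
    rewrite -ltnS => /(sumr_ge_term pos1) h; rewrite /C.
    have := C10 k M; have : 0 <= C0 k M * expR (E k)%:R.
      by rewrite mulr_ge0 ?expR_ge0.
    by split; lra.
  have CM k : (k < M)%N -> C0 k M <= C.
    move=> /(sumr_ge_term (F := fun k => C0 k M) (fun k => C00 k M)).
    by rewrite /C; lra.
  have C1P : 1 <= C by rewrite /C; lra.
  exists C; first exact: le_trans C1P.
  move=> x K xK; have K0 := bnd_ge0 xK; apply: bnd_idx => k p i j.
  rewrite /t /= idxkK idxpK idxiK Normc.normcM normc_cexp /v.
  have [nk|kn] := ltnP n k.
    (* On [A], m0 alpha_a <= om - s_k - s_k beta_j, which bounds the cost of passing to level
       [m0 k]. *)
    have xB : bnd (m0 k) M (lcoef (restr (B k p i j) x))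
        (K * expR (om k p i - (s k)%:R - (s k)%:R * beta j)).
      move=> a b; rewrite lcoef_restr; case: ifP => [/andP[Aab _]|_]; last first.
        by rewrite Normc.normc0 !mulr_ge0 ?expR_ge0.
      apply: (le_trans (xK a b)); rewrite -mulrA ler_wpM2l// -expRD ler_expR.
      move: Aab; rewrite /A /= => Aab.
      have : (m0 k)%:R * alpha a <= (s k)%:R * alpha a.
        by rewrite ler_wpM2r ?ler_nat// alpha_ge0.
      have : 0 <= m%:R * alpha a by rewrite mulr_ge0// alpha_ge0.
      lra.
    have := T0 _ _ _ _ xB i j; rewrite mul0r subr0 => h.
    have CNP : C0 k M * expR (om k p i - (s k)%:R - (s k)%:R * beta j) *
        expR ((N0 k M)%:R * beta j) <= C * expR (om k p i + N%:R * beta j).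
      have bj := beta_ge0 j.
      have sj : 0 <= (s k)%:R * beta j by rewrite mulr_ge0.
      (* For M <= k the factors exp(-s_k) and exp(-s_k beta_j) absorb [C0] and [N0]; the finitely
         many k < M are built into [C] and [N]. *)
      have [Mk|kM] := leqP M k.
        apply: (@le_trans _ _ (1 * expR (om k p i + N%:R * beta j))); last first.
          by rewrite ler_wpM2r ?expR_ge0.
        rewrite mul1r.
        apply: (@le_trans _ _ (expR (s k)%:R * expR (om k p i - (s k)%:R -
            (s k)%:R * beta j) * expR ((N0 k M)%:R * beta j))).
          by rewrite ler_wpM2r ?expR_ge0// ler_wpM2r ?expR_ge0 ?sC.
        rewrite -!expRD ler_expR.
        have : (N0 k M)%:R * beta j <= (s k)%:R * beta j.
          by rewrite ler_wpM2r ?ler_nat ?sN.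
        have : 0 <= N%:R * beta j by rewrite mulr_ge0.
        lra.
      rewrite -mulrA -expRD; apply: ler_pM; rewrite ?expR_ge0 ?CM// ler_expR.
      have : (N0 k M)%:R * beta j <= N%:R * beta j.
        by rewrite ler_wpM2r ?ler_nat ?NM.
      have : 0 <= (s k)%:R :> R by [].
      lra.
    apply: (@le_trans _ _ (expR (- (k%:R * om k p i)) *
        (K * (C * expR (om k p i + N%:R * beta j))))).
      rewrite ler_wpM2l ?expR_ge0//; apply: (le_trans h).
      rewrite [C0 k M * _]mulrCA -mulrA.
      by rewrite ler_wpM2l.
    rewrite mulrCA [expR _ * (C * _)]mulrCA -expRD [C * K]mulrC -[leRHS]mulrA.
    rewrite ler_wpM2l// ler_wpM2l ?(le_trans _ C1P)// ler_expR.
    (* Since k >= n + 1, exp(-k om) supplies exp(-n om) and also cancels exp(om). *)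
    have : (n%:R + 1) * om k p i <= k%:R * om k p i.
      by rewrite ler_wpM2r// natr1 ler_nat.
    lra.
  have ek1 : expR (- (k%:R * om k p i)) <= 1.
    by rewrite -expR0 ler_expR oppr_le0 mulr_ge0.
  apply: (@le_trans _ _ (1 * normc (lcoef (T k (restr (B k p i j) x)) (i, j)))).
    by rewrite ler_wpM2r ?normc_ge0.
  have [mk1 mk2] := mP k kn; have [Nk1 Nk2] := NP k kn.
  have [Ck1 Ck2] := Cge k kn.
  have bj := beta_ge0 j.
  rewrite mul1r; case: p {ek1} => [|p].
    have xm : bnd (m1 k) M (lcoef (restr (B k 0 i j) x)) K.
      by apply: bnd_restr; exact: bnd_weak xK.
    have := (T1 k M).2 _ _ xm i j => h; apply: (le_trans h).
    apply: ler_pM; rewrite ?mulr_ge0 ?expR_ge0// ?ler_wpM2r//.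
    rewrite ler_expR lerB//; first by rewrite ler_wpM2r ?ler_nat.
    by rewrite natrM -mulrA ler_wpM2l// om0_le.
  have xB : bnd (m0 k) M (lcoef (restr (B k p.+1 i j) x))
      (K * expR ((E k)%:R * (1 + beta j) - n%:R * om k p.+1 i)).
    move=> a b; rewrite lcoef_restr; case: ifP => [/andP[_ nA]|_]; last first.
      by rewrite Normc.normc0 !mulr_ge0 ?expR_ge0.
    apply: (le_trans (xK a b)); rewrite -mulrA ler_wpM2l// -expRD ler_expR.
    move: nA; rewrite /A /= -ltNge => /ltW nA.
    have : n%:R * om k p.+1 i <= (E k)%:R * (1 + alpha a + beta j).
      rewrite /E -mulnA natrM -mulrA ler_wpM2l// natrM -mulrA.
      by apply: (le_trans (omS_le aD _ _ _)); rewrite ler_wpM2l.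
    have : (E k + m0 k)%:R * alpha a <= m%:R * alpha a.
      by rewrite ler_wpM2r ?ler_nat// alpha_ge0.
    rewrite natrD; lra.
  have := T0 _ _ _ _ xB i j; rewrite mul0r subr0 => h; apply: (le_trans h).
  apply: (@le_trans _ _ (K * ((C0 k M * expR (E k)%:R) *
      expR ((N0 k M + E k)%:R * beta j - n%:R * om k p.+1 i)))).
    rewrite mulrCA -!mulrA ler_wpM2l// ler_wpM2l// -!expRD ler_expR natrD; lra.
  rewrite mulrA [C * K]mulrC -!mulrA ler_wpM2l// mulrA.
  apply: ler_pM; rewrite ?mulr_ge0 ?expR_ge0// ler_expR lerB//.
  by rewrite ler_wpM2r ?ler_nat.
- exists T' => // k x; apply: lcoef_inj => -[i j].
  apply: csums_unique (qE _ _ _ _) _.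
  have qv p : qterm k (T' x) i j p = v k p i j x.
    rewrite /qterm T'E /t /= idxkK idxpK idxiK mulrA -cexpD subrr cexp0.
    by rewrite mul1r.
  (* The sets [B] for r <= p partition [A] at p, so the partial sums collapse. *)
  have sumv p : \sum_(r < p.+1) qterm k (T' x) i j r =
      lcoef (T k (restr (A k p i j) x)) (i, j).
    elim: p => [|p IHp].
      rewrite big_ord_recl big_ord0 addr0 qv /v; congr (lcoef (T k _) _).
      by apply: lcoef_inj => ab; rewrite !lcoef_restr /B andbT.
    rewrite big_ord_recr /= IHp qv /v -lcoefD -(clinD (Tl k)).
    congr (lcoef (T k _) _); apply: lcoef_inj => ab.
    rewrite lcoefD !lcoef_restr /B; have : A k p i j ab -> A k p.+1 i j ab.
      by move=> /le_trans; apply; exact: om_le.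
    case: (A k p i j ab) => [->//|_]; rewrite ?andbF ?addr0// andbT add0r.
    by [].
  (* Outside [A], c s_k extra levels give exp(-c om_p) <= 2^-p up to a factor depending only on k
     and j, hence convergence to T_k x. *)
  have [M [K xK]] := lcoef_bnd x (m0 k + c * s k).
  have K0 := bnd_ge0 xK.
  have rest p : bnd (m0 k) M (lcoef (restr (fun ab => ~~ A k p i j ab) x))
      (K * expR ((c * s k)%:R * (1 + beta j)) / (2 ^ p)%:R).
    move=> a b; rewrite lcoef_restr; case: ifP => [nA|_]; last first.
      by rewrite Normc.normc0 !mulr_ge0 ?expR_ge0.
    move: nA; rewrite /A /= -ltNge => /ltW nA.
    apply: (@le_trans _ _ (K * expR ((c * s k)%:R * (1 + beta j)) *
        expR (- (c%:R * om k p i)) * expR (M%:R * beta b - (m0 k)%:R * alpha a))).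
      apply: (le_trans (xK a b)); rewrite -!mulrA ler_wpM2l// -!expRD ler_expR.
      have : c%:R * om k p i <= c%:R * ((s k)%:R * (1 + alpha a + beta j)).
        by rewrite ler_wpM2l.
      by rewrite [(m0 k + _)%:R]natrD [(c * _)%:R]natrM; lra.
    rewrite ler_wpM2r ?expR_ge0// ler_wpM2l ?mulr_ge0 ?expR_ge0//.
    exact: exp_om_le.
  pose K1 := C0 k M * (K * expR ((c * s k)%:R * (1 + beta j))) *
    expR ((N0 k M)%:R * beta j).
  have K10 : 0 <= K1 by rewrite /K1 !mulr_ge0 ?expR_ge0.
  (* The factor 2 accounts for p + 1 terms against 2^-p; the norm of the limit covers the empty
     sum. *)
  exists (2 * K1 + normc (lcoef (T k x) (i, j))) => -[|p].
    by rewrite big_ord0 sub0r normcN expn0 invr1 mulr1 lerDr mulr_ge0.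
  rewrite sumv -lcoefB -(clinB (Tl k)).
  have -> : restr (A k p i j) x - x = - restr (fun ab => ~~ A k p i j ab) x.
    apply: lcoef_inj => ab; rewrite lcoefB -[in RHS]sub0r lcoefB lcoef0.
    by rewrite !lcoef_restr; case: (A k p i j ab) => /=; rewrite ?subrr ?subr0.
  rewrite -[- _]sub0r (clinB (Tl k)) (clin0 (Tl k)) lcoefB lcoef0 sub0r normcN.
  have := T0 _ _ _ _ (rest p) i j; rewrite mul0r subr0 => h; apply: (le_trans h).
  rewrite (_ : C0 k M * _ * _ = K1 / (2 ^ p)%:R); last by rewrite /K1; ring.
  rewrite [(2 ^ p.+1)%N]expnS [(2 * _)%:R]natrM invfM mulrA.
  rewrite ler_wpM2r// mulrDl mulrAC divff// mul1r lerDl.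
  by rewrite mulr_ge0 ?normc_ge0.
- move=> a x y [n j]; rewrite /t /v restrP (Tl _).1 lcoefP; ring.
Qed.

End Operators.

(** * Assembly for L *)

Theorem theorem5p3 (R : realType) (alpha beta : exponent_sequence R)
    (X : tvsType R[i]) :
  condition_N alpha -> condition_N beta -> stable alpha ->
  hausdorff_space X ->
  complemented_in X (Lambda_infty alpha beta) ->
  complemented_in (Lambda_infty alpha beta) X ->
  tvs_iso X (Lambda_infty alpha beta).
Proof.
move=> /condition_N_nat[c ac] betaN /stable_nat[D D0 aD] _.
move=> /complemented_in_clin[i [r [il rl ir]]].
move=> /complemented_in_clin[i' [r' [i'l r'l ir']]].
have [s0 [s1 [t0 [t1 [[? ? ? ?] [? ? ? ? ?]]]]]] := even_odd_rows betaN D0 aD.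
have [q [ql qE]] := evaluations betaN ac.
have [S Sl SE] := differences betaN D0 aD.
(* The partial sum up to p is the single term [qterm k x a b p], which tends to 0 geometrically. *)
have qS k x : q k (S x) = 0.
  apply: lcoef_inj => -[a b]; rewrite lcoef0.
  have [N [K xK]] := lcoef_bnd x (0 + k + c).
  have K0 := bnd_ge0 xK.
  apply: csums_unique (qE _ _ _ _) _.
  exists (2 * (K * expR (N%:R * beta b))) => -[|p].
    by rewrite big_ord0 subrr Normc.normc0 !mulr_ge0 ?expR_ge0.
  rewrite SE subr0; apply: (le_trans (qterm_le ac a b p xK)).
  rewrite mul0r subr0; move: (K * _) => z.
  by rewrite expnS natrM invfM mulrA [2 * z]mulrC mulfK.
apply: (swindle (s0 := s0) (s1 := s1) (t0 := t0) (t1 := t1) (S := S) (q := q)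
  il rl ir i'l r'l ir') => //.
(* The partial sums of S x recover every coefficient of x up to a nonzero factor. *)
- move=> x y Sxy; apply: lcoef_inj => -[n j]; rewrite -[n]idxK.
  move: (idxk n) (idxp n) (idxi n) => k p a.
  have := SE x k p a j; rewrite Sxy SE => /esym; apply: mulfI.
  by apply: contraTneq (expR_gt0 (k%:R * om alpha k p a)) => e0;
    rewrite -normc_cexp e0 Normc.normc0 ltxx.
- by move=> W Wl qW; exact: (differences_ker_factor betaN ac qE SE Wl qW).
- by move=> T Tl; exact: (lifting betaN D0 aD ac qE Tl).
Qed.
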